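(* Let $k$ be an algebraically closed field of characteristic $p\ge 0$, let $A$ be an affine, noetherian, prime, PI Hopf $k$-algebra, and let $\pi:A\to k$ be an algebra homomorphism such that: the order $n$ of $\pi$ in $G(A^\circ)$ is equal to the PI-degree of $A$; the invariant subring $A^l_0$ of the left winding automorphism $\Xi^l_\pi$ is a Dedekind domain; and $n$ is coprime to $p$ if $p>0$. Suppose that $G^l_\pi\cap G^r_\pi=\{1\}$. Then $A_0=\widetilde{A_0}$; that is, $A_0=Z(A)$ is a Hopf subalgebra of $A$.
   Context: Affine means finitely generated as a $k$-algebra. $G(A^\circ)=\mathrm{Hom}_{k\text{-alg}}(A,k)$, a group under convolution. With $\Delta(a)=\sum a_1\otimes a_2$, the winding automorphisms are $\Xi^l_\pi(a)=\sum\pi(a_1)a_2$, $\Xi^r_\pi(a)=\sum a_1\pi(a_2)$; $G^l_\pi=\langle\Xi^l_\pi\rangle$ and $G^r_\pi=\langle\Xi^r_\pi\rangle$ are subgroups of $\mathrm{Aut}_{k\text{-alg}}(A)$; $A^l_0=A^{G^l_\pi}$, $A^r_0=A^{G^r_\pi}$, $A_0=A^l_0\cap A^r_0$; $\widetilde{A_0}=\{a\in A:\Delta(a)\in A_0\otimes A_0\}$, which is the largest Hopf subalgebra of $A$ contained in $A_0$. $Z(A)$ is the center. The PI-degree of an algebra $R$ is $\min\{m: R\hookrightarrow M_m(C)\text{ for some commutative ring }C\}$. The antipode of such an $A$ is automatically bijective. *)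

(* Defs.v *)
From HB Require Import structures.
From mathcomp Require Import all_boot all_order all_algebra.
From mathcomp Require Import finmap generic_quotient ring_quotient fraction.
From mathcomp Require Import monalg.
From mathcomp Require Import boolp classical_sets.

Set Implicit Arguments.
Unset Strict Implicit.
Unset Printing Implicit Defensive.

Import GRing.Theory.

Local Open Scope classical_set_scope.
Local Open Scope ring_scope.

(** * Tensor product of two vector spaces

   The quotient of the free vector space on [V * W] by the subspace spanned by
   the bilinearity relators. *)

Section TensorSpace.
Variables (k : fieldType) (V W : lmodType k).
Local Notation F := {malg k[(V * W)%type]}.

Inductive tens_rel : F -> Prop :=
| TensRel0 : tens_rel 0
| TensRelD x y : tens_rel x -> tens_rel y -> tens_rel (x + y)
| TensRelZ c x : tens_rel x -> tens_rel (c *: x)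
| TensRelL c v v' w :
    tens_rel (<< (c *: v + v', w) >> - c *: << (v, w) >> - << (v', w) >>)
| TensRelR c v w w' :
    tens_rel (<< (v, c *: w + w') >> - c *: << (v, w) >> - << (v, w') >>).

Definition tens_relb : {pred F} := fun x => `[< tens_rel x >].

Lemma tens_relbP x : reflect (tens_rel x) (x \in tens_relb).
Proof. exact: asboolP. Qed.

Fact tens_relb_zmod_closed : zmod_closed tens_relb.
Proof.
split=> [|x y /tens_relbP xr /tens_relbP yr]; apply/tens_relbP.
  exact: TensRel0.
by apply: TensRelD xr _; rewrite -scaleN1r; apply: TensRelZ.
Qed.

HB.instance Definition _ := GRing.isZmodClosed.Build F tens_relb
  tens_relb_zmod_closed.

(** The record keeps unification from unfolding the quotient. *)
Record tens := Tens { tens_val : Quotient.quot (tens_relb : zmodClosed F) }.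

HB.instance Definition _ := [isNew for tens_val].
HB.instance Definition _ := [Choice of tens by <:].

Local Open Scope quotient_scope.

Definition tens_pi (x : F) : tens := Tens (\pi x).
Definition tens_repr (t : tens) : F := repr (tens_val t).

Lemma tens_piP x y : tens_pi x = tens_pi y <-> tens_rel (x - y).
Proof.
split=> [[e]|r].
  by apply/tens_relbP; rewrite Quotient.idealrBE; apply/eqP.
by congr Tens; apply/eqP; rewrite -Quotient.idealrBE; apply/tens_relbP.
Qed.

Lemma tens_reprK t : tens_pi (tens_repr t) = t.
Proof. by case: t => t; rewrite /tens_pi reprK. Qed.

Lemma tens_repr_pi x : tens_rel (tens_repr (tens_pi x) - x).
Proof. by apply/tens_piP; rewrite tens_reprK. Qed.

Definition tens_add s t := Tens (tens_val s + tens_val t).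
Definition tens_opp t := Tens (- tens_val t).
Definition tens_zero := Tens 0.

Fact tens_addA : associative tens_add.
Proof. by move=> s t u; congr Tens; rewrite /= addrA. Qed.
Fact tens_addC : commutative tens_add.
Proof. by move=> s t; congr Tens; rewrite addrC. Qed.
Fact tens_add0 : left_id tens_zero tens_add.
Proof. by case=> t; congr Tens; rewrite add0r. Qed.
Fact tens_addN : left_inverse tens_zero tens_opp tens_add.
Proof. by case=> t; congr Tens; rewrite addNr. Qed.

HB.instance Definition _ := GRing.isZmodule.Build tens
  tens_addA tens_addC tens_add0 tens_addN.

Lemma tens_piD x y : tens_pi (x + y) = tens_pi x + tens_pi y.
Proof. by congr Tens; rewrite raddfD. Qed.

Definition tens_scale (c : k) (t : tens) : tens := tens_pi (c *: tens_repr t).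

Lemma tens_scale_pi c x : tens_scale c (tens_pi x) = tens_pi (c *: x).
Proof.
apply/tens_piP; rewrite -scalerBr; apply: TensRelZ; exact: tens_repr_pi.
Qed.

Fact tens_scaleA a b t : tens_scale a (tens_scale b t) = tens_scale (a * b) t.
Proof. by rewrite -(tens_reprK t) !tens_scale_pi scalerA. Qed.
Fact tens_scale1 : left_id 1 tens_scale.
Proof. by move=> t; rewrite -(tens_reprK t) tens_scale_pi scale1r. Qed.
Fact tens_scaleDr : right_distributive tens_scale +%R.
Proof.
move=> c s t; rewrite -(tens_reprK s) -(tens_reprK t) -tens_piD.
by rewrite !tens_scale_pi scalerDr tens_piD.
Qed.
Fact tens_scaleDl t : {morph tens_scale^~ t : a b / a + b}.
Proof.
by move=> a b; rewrite -(tens_reprK t) !tens_scale_pi scalerDl tens_piD.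
Qed.

HB.instance Definition _ := GRing.Zmodule_isLmodule.Build k tens
  tens_scaleA tens_scale1 tens_scaleDr tens_scaleDl.

Lemma tens_piZ c x : tens_pi (c *: x) = c *: tens_pi x.
Proof. by rewrite -tens_scale_pi. Qed.

End TensorSpace.

HB.lock Definition tensor (k : fieldType) (V W : lmodType k) (v : V) (w : W) :
  tens V W := tens_pi << (v, w) >>.

Notation "v ⊗ w" := (tensor v w) (at level 40, no associativity) : ring_scope.

Section TensorTheory.
Variables (k : fieldType) (V W : lmodType k).
Local Notation F := {malg k[(V * W)%type]}.
Local Notation tens := (tens V W).

Lemma tensor_bilinear : bilinear_for *:%R *:%R (@tensor k V W).
Proof.
rewrite tensor.unlock; split=> u c v v' /=; rewrite -tens_piZ -tens_piD; apply/tens_piP;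
  rewrite opprD addrA; first exact: TensRelL.
exact: TensRelR.
Qed.

Lemma tens_ind (P : tens -> Prop) :
  P 0 -> (forall s t, P s -> P t -> P (s + t)) ->
  (forall v w, P (tensor v w)) -> forall t, P t.
Proof.
move=> P0 PD Pt t; rewrite -(tens_reprK t) [tens_repr t]monalgE.
elim/big_ind: _ => [|x y Px Py|[v w] _].
- have -> // : tens_pi (0 : F) = 0 :> tens.
  by rewrite -[in LHS](scaler0 _ (0 : k)) tens_piZ scale0r.
- by rewrite tens_piD; apply: PD.
- set c := _@__; have -> : << c *g (v, w) >> = c *: << (v, w) >> :> F.
    by apply/malgP=> q; rewrite mcoeffZ !mcoeffU mulrnAr mulr1.
  rewrite tens_piZ.
  have -> : tens_pi << (v, w) >> = v ⊗ w by rewrite tensor.unlock.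
  have h0 : (0 : V) ⊗ w = 0.
    have := tensor_bilinear.1 w (-1) 0 0.
    by rewrite /= scaler0 addr0 scaleN1r addNr.
  have := tensor_bilinear.1 w c v 0; rewrite /= h0 !addr0 => <-.
  exact: Pt.
Qed.

End TensorTheory.

Definition free_lift (k : fieldType) (V W U : lmodType k)
    (f : V -> W -> U) (x : {malg k[(V * W)%type]}) : U :=
  \sum_(q <- msupp x) x@_q *: f q.1 q.2.

(** The linear map out of [tens V W] induced by a bilinear map [f]; meaningful
   only when [f] is bilinear. *)
HB.lock Definition tlift (k : fieldType) (V W U : lmodType k)
    (f : V -> W -> U) (t : tens V W) : U := free_lift f (tens_repr t).

Section TensorLift.
Variables (k : fieldType) (V W U : lmodType k).
Local Notation F := {malg k[(V * W)%type]}.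

Lemma free_liftEw (f : V -> W -> U) (d : {fset V * W}) (x : F) : (msupp x `<=` d)%fset ->
  free_lift f x = \sum_(q <- d) x@_q *: f q.1 q.2.
Proof.
move=> sxd; rewrite /free_lift; apply: big_fset_incl => // q _.
by move=> /mcoeff_outdom ->; rewrite scale0r.
Qed.

Lemma free_lift_linear (f : V -> W -> U) : linear (free_lift f).
Proof.
move=> c x y; set d := (msupp (c *: x + y) `|` msupp x `|` msupp y)%fset.
rewrite !(@free_liftEw f d) /d; first last.
- by rewrite -fsetUA fsubsetUl.
- by rewrite fsetUC fsetUA fsubsetUr.
- exact: fsubsetUr.
rewrite scaler_sumr -big_split /=; apply: eq_bigr => q _.
by rewrite mcoeffD mcoeffZ scalerDl scalerA.
Qed.

Lemma free_lift1 (f : V -> W -> U) v w : free_lift f << (v, w) >> = f v w.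
Proof.
by rewrite (free_liftEw f (msuppU_le (x := 1))) big_seq_fset1 mcoeffUU scale1r.
Qed.

Variable f : V -> W -> U.
Hypothesis f_bilin : bilinear_for *:%R *:%R f.

Lemma free_lift_rel x : tens_rel x -> free_lift f x = 0.
Proof.
have [fl fr] := f_bilin.
pose L := GRing.isLinear.Build _ _ _ _ (free_lift f) (free_lift_linear f).
pose fL : {linear F -> U} := HB.pack (free_lift f) L.
have E : free_lift f = fL by [].
elim=> [|y z _ yr _ zr|c y _ yr|c v v' w|c v w w'].
- by rewrite E linear0.
- by move: yr zr; rewrite E linearD => -> ->; rewrite addr0.
- by move: yr; rewrite E linearZ /= => ->; rewrite scaler0.
- rewrite E !linearB linearZ /= !free_lift1.
  by rewrite [f (c *: v + v') w]fl addrAC addrK subrr.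
- rewrite E !linearB linearZ /= !free_lift1.
  by rewrite [f v (c *: w + w')]fr addrAC addrK subrr.
Qed.

Lemma tlift_pi x : tlift f (tens_pi x) = free_lift f x.
Proof.
rewrite tlift.unlock; apply/subr0_eq; rewrite -(free_lift_rel (tens_repr_pi x)) addrC.
by rewrite [in RHS]addrC -!scaleN1r free_lift_linear.
Qed.

Lemma tliftE v w : tlift f (v ⊗ w) = f v w.
Proof. by rewrite tensor.unlock tlift_pi free_lift1. Qed.

Lemma tlift_linear : linear (tlift f).
Proof.
move=> c s t; rewrite -(tens_reprK s) -(tens_reprK t).
by rewrite -tens_piZ -tens_piD !tlift_pi free_lift_linear.
Qed.

Lemma tliftD s t : tlift f (s + t) = tlift f s + tlift f t.
Proof. by have := tlift_linear 1 s t; rewrite !scale1r. Qed.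

Lemma tlift0 : tlift f 0 = 0.
Proof. by apply: (addrI (tlift f 0)); rewrite -tliftD !addr0. Qed.

End TensorLift.

Definition tmap (k : fieldType) (V W V' W' : lmodType k)
    (f : V -> V') (g : W -> W') : tens V W -> tens V' W' :=
  tlift (fun v w => f v ⊗ g w).

Definition tassoc (k : fieldType) (U V W : lmodType k) :
    tens (tens U V) W -> tens U (tens V W) :=
  tlift (fun s w => tlift (fun u v => u ⊗ (v ⊗ w)) s).

(** The subspace of [tens V W] spanned by the [b ⊗ c] with [b \in B] and
   [c \in C]; as [k] is a field this is the tensor product of [B] and [C] when
   these are subspaces. *)
Definition tens_sub (k : fieldType) (V W : lmodType k)
    (B : set V) (C : set W) : set (tens V W) :=
  [set t | exists2 s : seq (V * W),
     (forall q, q \in s -> B q.1 /\ C q.2) & t = \sum_(q <- s) q.1 ⊗ q.2].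

Lemma tensE (k : fieldType) (V W : lmodType k) (c : k) (v v' : V) (w w' : W) :
  ((v + v') ⊗ w = v ⊗ w + v' ⊗ w) * (v ⊗ (w + w') = v ⊗ w + v ⊗ w') *
  ((c *: v) ⊗ w = c *: (v ⊗ w)) * (v ⊗ (c *: w) = c *: (v ⊗ w)) *
  ((0 : V) ⊗ w = 0) * (v ⊗ (0 : W) = 0).
Proof.
have [hl hr] := tensor_bilinear V W.
have hDl (x y : V) (z : W) : (x + y) ⊗ z = x ⊗ z + y ⊗ z.
  by have := hl z 1 x y; rewrite /= !scale1r.
have hDr (x : V) (y z : W) : x ⊗ (y + z) = x ⊗ y + x ⊗ z.
  by have := hr x 1 y z; rewrite /= !scale1r.
have h0l (z : W) : (0 : V) ⊗ z = 0.
  by apply: (addrI ((0 : V) ⊗ z)); rewrite -hDl !addr0.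
have h0r (x : V) : x ⊗ (0 : W) = 0.
  by apply: (addrI (x ⊗ (0 : W))); rewrite -hDr !addr0.
do !split=> //; first by have := hl w c v 0; rewrite /= h0l !addr0.
by have := hr v c w 0; rewrite /= h0r !addr0.
Qed.

(** * Tensor product of two algebras: [(a ⊗ b) * (c ⊗ d) = (a * c) ⊗ (b * d)] *)

Section TensorAlgebra.
Variables (k : fieldType) (A B : algType k).
Local Notation T := (tens A B).

Definition tens_mul (s t : T) : T :=
  tlift (fun a b => tlift (fun c d => (a * c) ⊗ (b * d)) t) s.

Fact tens_mul_inner a b :
  bilinear_for *:%R *:%R (fun (c : A) (d : B) => (a * c) ⊗ (b * d)).
Proof.
by split=> u x y z /=; rewrite mulrDr -scalerAr !tensE.
Qed.

Fact tens_mul_outer t : bilinear_for *:%R *:%R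
  (fun (a : A) (b : B) => tlift (fun c d => (a * c) ⊗ (b * d)) t).
Proof.
have D a b := tliftD (tens_mul_inner a b).
have Z a b := tlift0 (tens_mul_inner a b).
have E a b := tliftE (tens_mul_inner a b).
split=> u x y z /=; elim/tens_ind: t => [|s t ihs iht|c d].
- by rewrite !Z scaler0 addr0.
- by rewrite (D _ _ s) (D y _ s) (D z _ s) ihs iht scalerDr addrACA.
- by rewrite !E mulrDl -scalerAl !tensE.
- by rewrite !Z scaler0 addr0.
- by rewrite (D _ _ s) (D _ y s) (D _ z s) ihs iht scalerDr addrACA.
- by rewrite !E mulrDl -scalerAl !tensE.
Qed.

Lemma tens_mulE a b c d : tens_mul (a ⊗ b) (c ⊗ d) = (a * c) ⊗ (b * d).
Proof.
by rewrite /tens_mul (tliftE (tens_mul_outer _)) (tliftE (tens_mul_inner _ _)).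
Qed.

Lemma tens_mul_linearl t : linear (tens_mul^~ t).
Proof. exact: (tlift_linear (tens_mul_outer t)). Qed.

Lemma tens_mul_linearr s : linear (tens_mul s).
Proof.
move=> c x y; elim/tens_ind: s => [|s t ihs iht|a b].
- have h0 z : tens_mul 0 z = 0.
    by have := tens_mul_linearl z (-1) 0 0; rewrite scaler0 addr0 scaleN1r addNr.
  by rewrite !h0 scaler0 addr0.
- have hD z : tens_mul (s + t) z = tens_mul s z + tens_mul t z.
    by have := tens_mul_linearl z 1 s t; rewrite !scale1r.
  by rewrite !hD ihs iht scalerDr addrACA.
- have E z : tens_mul (a ⊗ b) z = tlift (fun c d => (a * c) ⊗ (b * d)) z.
    exact: (tliftE (tens_mul_outer z)).
  by rewrite (E (_ + _)) (E x) (E y) (tlift_linear (tens_mul_inner a b)).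
Qed.

Fact tens_mulDl : left_distributive tens_mul +%R.
Proof. by move=> s t u; have := tens_mul_linearl u 1 s t; rewrite !scale1r. Qed.
Fact tens_mulDr : right_distributive tens_mul +%R.
Proof. by move=> s t u; have := tens_mul_linearr s 1 t u; rewrite !scale1r. Qed.
Fact tens_mul0l t : tens_mul 0 t = 0.
Proof. by apply: (addrI (tens_mul 0 t)); rewrite -tens_mulDl !addr0. Qed.
Fact tens_mul0r t : tens_mul t 0 = 0.
Proof. by apply: (addrI (tens_mul t 0)); rewrite -tens_mulDr !addr0. Qed.

Fact tens_mulA : associative tens_mul.
Proof.
move=> s t u; elim/tens_ind: s => [|s s' hs hs'|a b].
- by rewrite !tens_mul0l.
- by rewrite !tens_mulDl hs hs'.
elim/tens_ind: t => [|t t' ht ht'|c d].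
- by rewrite !(tens_mul0l, tens_mul0r).
- by rewrite !(tens_mulDl, tens_mulDr) ht ht'.
elim/tens_ind: u => [|u u' hu hu'|e f].
- by rewrite !tens_mul0r.
- by rewrite !tens_mulDr hu hu'.
by rewrite !tens_mulE !mulrA.
Qed.

Fact tens_mul1l : left_id (1 ⊗ 1) tens_mul.
Proof.
by elim/tens_ind=> [|s t hs ht|a b]; rewrite ?tens_mul0r ?tens_mulDr ?hs ?ht //
  tens_mulE !mul1r.
Qed.
Fact tens_mul1r : right_id (1 ⊗ 1) tens_mul.
Proof.
by elim/tens_ind=> [|s t hs ht|a b]; rewrite ?tens_mul0l ?tens_mulDl ?hs ?ht //
  tens_mulE !mulr1.
Qed.

HB.instance Definition _ := GRing.Zmodule_isPzRing.Build T
  tens_mulA tens_mul1l tens_mul1r tens_mulDl tens_mulDr.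

End TensorAlgebra.

(** * Hopf algebras *)

HB.mixin Record Algebra_isHopf (k : fieldType) A of GRing.Algebra k A := {
  comul : A -> tens A A;
  counit : A -> k;
  antipode : A -> A;
  comul_linear : linear comul;
  comul_monoid_morphism : monoid_morphism comul;
  counit_scalar : scalar counit;
  counit_monoid_morphism : monoid_morphism counit;
  antipode_linear : linear antipode;
  comulA : forall a,
    tassoc (tmap comul id (comul a)) = tmap id comul (comul a);
  counitl : forall a, tlift (fun x y => counit x *: y) (comul a) = a;
  counitr : forall a, tlift (fun x y => counit y *: x) (comul a) = a;
  antipodel : forall a,
    tlift (fun x y => antipode x * y) (comul a) = (counit a)%:A;
  antipoder : forall a,
    tlift (fun x y => x * antipode y) (comul a) = (counit a)%:A
}.

#[short(type="hopfAlgType")]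
HB.structure Definition HopfAlgebra (k : fieldType) :=
  {A of Algebra_isHopf k A & GRing.Algebra k A}.

Section Hopf.
Variables (k : fieldType) (A : hopfAlgType k).
Implicit Types (pi f g : A -> k) (B C : set A) (a b : A).

Definition conv f g a : k :=
  tlift (fun x y => f x * g y : k^o) (comul a).

(** The powers and the order of [f] in the group of characters of [A] under
   convolution, whose unit is the counit. *)
Definition conv_exp f (m : nat) : A -> k := iter m (conv f) (@counit k A).

Definition conv_order f (n : nat) : Prop :=
  [/\ (0 < n)%N, conv_exp f n = @counit k A &
      forall m, (0 < m)%N -> conv_exp f m = @counit k A -> (n <= m)%N].

Definition winding_l pi a : A := tlift (fun x y => pi x *: y) (comul a).
Definition winding_r pi a : A := tlift (fun x y => pi y *: x) (comul a).

(** The cyclic group of permutations of [A] generated by [s]. *)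
Definition cyclic_group (s : A -> A) : set (A -> A) :=
  [set t | exists m : nat, t = iter m s \/
     (cancel t (iter m s) /\ cancel (iter m s) t)].

Definition fixed_by (G : set (A -> A)) : set A :=
  [set a | forall t : A -> A, G t -> t a = a].

(** [A0l], [A0r] are the invariants of the left and right winding automorphisms
   of [pi]; [A0tilde] is the largest Hopf subalgebra contained in [A0]. *)
Definition Gl pi := cyclic_group (winding_l pi).
Definition Gr pi := cyclic_group (winding_r pi).
Definition A0l pi := fixed_by (Gl pi).
Definition A0r pi := fixed_by (Gr pi).
Definition A0 pi := A0l pi `&` A0r pi.
Definition A0tilde pi : set A :=
  [set a | tens_sub (A0 pi) (A0 pi) (comul a)].

End Hopf.

(** * Ring-theoretic notions *)

Section Rings.
Variable R : nzRingType.
Implicit Types (I J : set R).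

Definition additive_subgroup I :=
  I 0 /\ forall x y, I x -> I y -> I (x - y).
Definition left_ideal I :=
  additive_subgroup I /\ forall r x, I x -> I (r * x).
Definition right_ideal I :=
  additive_subgroup I /\ forall r x, I x -> I (x * r).
Definition ideal I := left_ideal I /\ right_ideal I.

Definition acc (P : set R -> Prop) :=
  forall I : nat -> set R, (forall m, P (I m)) ->
    (forall m, I m `<=` I m.+1) ->
  exists N, forall m, (N <= m)%N -> I m = I N.

Definition noetherian := acc left_ideal /\ acc right_ideal.

Definition prime_ring := forall I J, ideal I -> ideal J ->
  (forall x y, I x -> J y -> x * y = 0) -> I = [set 0] \/ J = [set 0].

Definition center : set R := [set x | forall y, x * y = y * x].

(** [m = 0] is ruled out by injectivity, ['M[C]_0] being the zero ring. *)
Definition embeds_in_matrices (m : nat) :=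
  exists (C : comPzRingType) (f : {rmorphism R -> 'M[C]_m}), injective f.

Definition PI_degree (n : nat) :=
  embeds_in_matrices n /\ forall m, embeds_in_matrices m -> (n <= m)%N.

End Rings.

Arguments center R : clear implicits.

Section Algebras.
Variables (k : fieldType) (A : algType k).

Definition subalgebra (B : set A) := [/\ B 1,
  forall (c : k) x y, B x -> B y -> B (c *: x + y) &
  forall x y, B x -> B y -> B (x * y)].

Definition affine := exists s : seq A, forall B : set A,
  subalgebra B -> (forall x, x \in s -> B x) -> B = setT.

(** [F] is a noncommutative polynomial in [m] variables. *)
Definition PI_algebra := exists (m : nat) (F : {malg k[{fmonom 'I_m}]}),
  F != 0 /\ forall v : 'I_m -> A,
    mmap (in_alg A) (fun w : {fmonom 'I_m} => \prod_(i <- w) v i) F = 0.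

End Algebras.

Definition Hopf_subalgebra (k : fieldType) (A : hopfAlgType k) (B : set A) :=
  [/\ subalgebra B, forall b, B b -> tens_sub B B (comul b) &
      forall b, B b -> B (antipode b)].

(** Fields count as Dedekind domains. *)
Definition Dedekind_domain (D : idomainType) := [/\ noetherian D,
  forall x : {fraction D},
    integralOver (@FracField.tofrac D) x -> exists d, x = FracField.tofrac d &
  forall P : set D, ideal P -> ~ P 1 ->
    (forall x y, P (x * y) -> P x \/ P y) -> P <> [set 0] ->
    forall J, ideal J -> P `<=` J -> J = P \/ J = setT].

(** The subset [S] is a subring of [R] that is a Dedekind domain, presented as
   the image of an injective ring morphism. *)
Definition Dedekind_subring (R : nzRingType) (S : set R) :=
  exists (D : idomainType) (f : {rmorphism D -> R}),
    [/\ Dedekind_domain D, injective f & range f = S].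

Definition has_characteristic (R : nzRingType) (p : nat) :=
  (p = 0%N /\ [pchar R] =i pred0) \/ p \in [pchar R].

(* Main.v *)
Require Import Defs.
From HB Require Import structures.
From mathcomp Require Import all_boot all_order all_algebra.
From mathcomp Require Import boolp classical_sets.
From mathcomp Require Import generic_quotient ring_quotient.
From mathcomp Require Import cyclic separable cyclotomic.

Set Implicit Arguments.
Unset Strict Implicit.
Unset Printing Implicit Defensive.

Import GRing.Theory.

Local Open Scope classical_set_scope.
Local Open Scope ring_scope.

(** Let [l] and [r] be the left and right winding automorphisms of [pi] and [w]
   a primitive [n]-th root of unity. They commute and have order [n], so [A] is
   bigraded by their eigenvalues: [A_ij] is the space of [a] with
   [l a = w ^+ i *: a] and [r a = w ^+ j *: a], and [A0 pi] is [A_00]. Windings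
   interact with the coproduct: [comul] maps [A_ij] to the sum over [s] of the
   [A_is ⊗ A_sj], and the antipode [S] maps [A_ij] to [A_(-j)(-i)].

   The grading by [l] is strong: for [b] in [A_ii] with counit [1], the sum of
   the [b_1 S(b_2)] writes [1] in terms of products of elements of opposite
   degrees; such a [b] exists because a proper subgroup of degrees would give
   [pi] an order below [n] ([counit_neq0_degree]). As [D = A0l pi] is a
   commutative domain, nonzero homogeneous elements are regular, the components
   have rank one over [D], and each degree [i] has a twist: an automorphism of
   [D] expressing how the elements of degree [i] commute with [D]. If the twist
   of some [i] not divisible by [n] were trivial, [A] would have rank [e < n]
   over a commutative subring and would embed in matrices of size [e], against
   the PI-degree ([commuting_degree_eq0]); hence the center lies in [D].

   The right grading has the same properties once [A0r pi] is known to be a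
   commutative domain. This holds because [S] maps it to [D], reversing
   products, and [S] is injective ([antipode_injective]): in matrices over [A],
   one-sided inverses are two-sided, since [A] embeds in matrices over a
   commutative ring. So the center lies in [A_00].

   Conversely, no [A_0j] vanishes: otherwise a power of [r] below the [n]-th
   would be the identity on [D], hence act by a scalar on each component of the
   left grading, and be a power of [l], against the triviality of the
   intersection of [Gl pi] and [Gr pi] ([degl0_degr_nonzero]). A nonzero element
   of [A_0j] commutes with [A_00], as both lie in [D], so the twist of degree
   [j] of the right grading fixes [A_00]; thus [A_00] is the center.

   Finally let [z] be in [A_00]; the component [T_s] of [comul z] lies in
   [A_0s ⊗ A_s0]. For [x] nonzero in [A_10], [comul x] commutes with [comul z],
   while [comul x * T_s = zeta_s *: (T_s * comul x)] with [zeta_s] different from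
   [1] unless [n] divides [s] ([bidegree_commutation]). Since [comul x] is
   regular ([comul_regular]), [T_s] vanishes for these [s], and [comul z] lies
   in [A_00 ⊗ A_00]. *)

(** * Linear functionals and tensors *)

(** A subspace that contains [U], avoids [v] and is maximal for this is a
   complement of the line of [v]; the coefficient of [v] is the functional. *)
Lemma functional_vanishing_on (k : fieldType) (V : lmodType k) (U : set V)
    (v : V) :
    U 0 -> (forall c x y, U x -> U y -> U (c *: x + y)) -> ~ U v ->
  exists f : V -> k, [/\ scalar f, forall u, U u -> f u = 0 & f v = 1].
Proof.
move=> U0 UL Uv.
(* [set0] is allowed because it is the union of the empty chain *)
pose P (M : set V) := (M = set0) \/ [/\ U `<=` M,
  forall c x y, M x -> M y -> M (c *: x + y) & ~ M v].
have [M [PM Mmax]] : exists M, P M /\ forall B, M `<` B -> ~ P B.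
  apply: Zorn_bigcup => F FP Ftot.
  have [FE|/existsNP [N0 /not_implyP [FN0 N00]]] :=
      pselect (forall N, F N -> N = set0).
    by left; apply/seteqP; split=> // x [N FN]; rewrite (FE _ FN).
  right.
  have PN N : F N -> N <> set0 -> [/\ U `<=` N,
      forall c x y, N x -> N y -> N (c *: x + y) & ~ N v].
    by move=> FN NN; have [] := FP _ FN.
  split.
  - have [UN _ _] := PN _ FN0 N00.
    by move=> u Uu; exists N0 => //; apply: UN.
  - move=> c x y [N FN Nx] [N' FN' Ny].
    have [NN|NN] := Ftot _ _ FN FN'.
      exists N' => //.
      have [] := PN _ FN'; first by move=> E; rewrite E in Ny.
      by move=> _ NL _; apply: NL => //; apply: NN.
    exists N => //.
    have [] := PN _ FN; first by move=> E; rewrite E in Nx.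
    by move=> _ NL _; apply: NL => //; apply: NN.
  - move=> [N FN Nv]; have [] := PN _ FN; first by move=> E; rewrite E in Nv.
    by move=> _ _; apply.
have [UM ML Mv] : [/\ U `<=` M,
    forall c x y, M x -> M y -> M (c *: x + y) & ~ M v].
  case: PM => // M0; exfalso; apply: (Mmax U).
    rewrite M0; split=> // H; exact: (H _ U0).
  by right; split.
have M0 : M 0 by exact: UM.
have MZ c x : M x -> M (c *: x) by move=> Mx; rewrite -[_ *: _]addr0; apply: ML.
have MD x y : M x -> M y -> M (x + y).
  by move=> Mx My; rewrite -[x]scale1r; apply: ML.
have MB x y : M x -> M y -> M (x - y).
  by move=> Mx My; rewrite addrC -scaleN1r; apply: ML.
have cx x : exists c : k, M (x - c *: v).
  have [Mx|Mx] := pselect (M x); first by exists 0; rewrite scale0r subr0.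
  pose M' := [set y | exists m c, M m /\ y = m + c *: x].
  have M'v : M' v.
    apply: contrapT => M'v; apply: (Mmax M').
      split.
        by move=> m Mm; exists m, 0; rewrite scale0r addr0.
      by move=> H; apply/Mx/H; exists 0, 1; rewrite scale1r add0r.
    right; split=> //.
      by move=> u Uu; exists u, 0; rewrite scale0r addr0; split=> //; apply: UM.
    move=> c _ _ [m [d [Mm ->]]] [m' [d' [Mm' ->]]].
    exists (c *: m + m'), (c * d + d'); split; first exact: ML.
    by rewrite scalerDr scalerDl scalerA addrACA.
  have [m [c [Mm vE]]] := M'v.
  have c0 : c != 0.
    by apply/eqP => c0; apply: Mv; rewrite vE c0 scale0r addr0.
  exists c^-1; rewrite vE scalerDr scalerA mulVf // scale1r.
  by rewrite opprD addrCA subrr addr0 -scaleN1r; apply/MZ/MZ.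
have [f fP] := choice cx.
have fU x c : M (x - c *: v) -> f x = c.
  move=> Mx; apply/eqP; rewrite -subr_eq0; apply/negPn/negP => d0.
  apply: Mv; rewrite -[v]scale1r -(mulVf d0) -scalerA; apply: MZ.
  have -> : (f x - c) *: v = (x - c *: v) - (x - f x *: v).
    by rewrite scalerBl opprB [RHS]addrC addrA subrK.
  exact: MB.
exists f; split.
- move=> c x y; apply: fU.
  have -> : c *: x + y - (c * f x + f y) *: v =
     c *: (x - f x *: v) + (y - f y *: v).
    by rewrite scalerDl scalerBr scalerA opprD addrACA.
  exact: ML.
- by move=> u Uu; apply: fU; rewrite scale0r subr0; apply: UM.
- by apply: fU; rewrite scale1r subrr.
Qed.

Section Independence.
Variables (k : fieldType) (V : lmodType k).

Lemma functional_separates (v : V) :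
  (forall f : V -> k, scalar f -> f v = 0) -> v = 0.
Proof.
move=> H; apply: contrapT => v0.
have [//|||f [fl _ f1]] := @functional_vanishing_on k V [set 0] v.
- by move=> c x y /= -> ->; rewrite scaler0 addr0.
- by apply: v0.
by move: f1; rewrite H // => /esym/eqP; rewrite oner_eq0.
Qed.

Definition independent (d : nat) (v : 'I_d -> V) :=
  forall c : 'I_d -> k, \sum_i c i *: v i = 0 -> forall i, c i = 0.

Lemma coordinate_functional d (v : 'I_d -> V) : independent v ->
  forall i, exists f : V -> k, scalar f /\ forall j, f (v j) = (j == i)%:R.
Proof.
move=> vi i.
pose U := [set x | exists c : 'I_d -> k, c i = 0 /\ x = \sum_j c j *: v j].
have [||| f [fl fU f1]] := @functional_vanishing_on k V U (v i).
- exists (fun=> 0); split=> //.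
  by rewrite big1 // => j _; rewrite scale0r.
- move=> a _ _ [c [c0 ->]] [d' [d0 ->]].
  exists (fun j => a * c j + d' j); split; first by rewrite c0 d0 mulr0 addr0.
  rewrite scaler_sumr -big_split /=; apply: eq_bigr => j _.
  by rewrite scalerDl scalerA.
- move=> [c [c0 vE]].
  have := vi (fun j => c j - (j == i)%:R).
  rewrite (eq_bigr (fun j => c j *: v j - (j == i)%:R *: v j)); last first.
    by move=> j _; rewrite scalerBl.
  rewrite sumrB -vE (bigD1 i) //= eqxx scale1r big1 ?addr0 ?subrr.
    move=> /(_ erefl i); rewrite c0 eqxx sub0r => /eqP.
    by rewrite oppr_eq0 oner_eq0.
  by move=> j /negPf ->; rewrite scale0r.
exists f; split=> // j; case: eqP => [->//|/eqP ji].
apply: fU; exists (fun l => (l == j)%:R); split.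
  by rewrite eq_sym (negPf ji).
rewrite (bigD1 j) //= eqxx scale1r big1 ?addr0 // => l /negPf ->.
by rewrite scale0r.
Qed.

End Independence.

Section LinearFunctions.
Variables (k : fieldType) (V W : lmodType k) (f : V -> W).
Hypothesis fl : linear f.

Lemma linear_fun0 : f 0 = 0.
Proof. by have := fl (-1) 0 0; rewrite scaler0 addr0 scaleN1r addNr. Qed.

Lemma linear_funD x y : f (x + y) = f x + f y.
Proof. by have := fl 1 x y; rewrite !scale1r. Qed.

Lemma linear_funZ c x : f (c *: x) = c *: f x.
Proof. by have := fl c x 0; rewrite linear_fun0 !addr0. Qed.

Lemma linear_funB x y : f (x - y) = f x - f y.
Proof. by rewrite addrC -scaleN1r fl scaleN1r addrC. Qed.

Lemma linear_fun_sum (I : Type) (r : seq I) (P : pred I) (F : I -> V) :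
  f (\sum_(i <- r | P i) F i) = \sum_(i <- r | P i) f (F i).
Proof. exact: (big_morph f linear_funD linear_fun0). Qed.

End LinearFunctions.

Lemma sum_linear (k : fieldType) (V W : lmodType k) (I : Type) (r : seq I)
    (F : I -> V -> W) :
  (forall i, linear (F i)) -> linear (fun x => \sum_(i <- r) F i x).
Proof.
move=> Fl c x y; rewrite scaler_sumr -big_split /=.
by apply: eq_bigr => i _; apply: Fl.
Qed.

Section Tensors.
Variables (k : fieldType) (V W : lmodType k).

Lemma tensDl (v v' : V) (w : W) : (v + v') ⊗ w = v ⊗ w + v' ⊗ w.
Proof. exact: linear_funD ((tensor_bilinear V W).1 w) v v'. Qed.

Lemma tensDr (v : V) (w w' : W) : v ⊗ (w + w') = v ⊗ w + v ⊗ w'.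
Proof. exact: linear_funD ((tensor_bilinear V W).2 v) w w'. Qed.

Lemma tensZl c (v : V) (w : W) : (c *: v) ⊗ w = c *: (v ⊗ w).
Proof. exact: linear_funZ ((tensor_bilinear V W).1 w) c v. Qed.

Lemma tensZr c (v : V) (w : W) : v ⊗ (c *: w) = c *: (v ⊗ w).
Proof. exact: linear_funZ ((tensor_bilinear V W).2 v) c w. Qed.

Lemma tens_sum (t : tens V W) :
  exists s : seq (V * W), t = \sum_(q <- s) q.1 ⊗ q.2.
Proof.
elim/tens_ind: t => [|_ _ [s ->] [t ->]|v w].
- by exists [::]; rewrite big_nil.
- by exists (s ++ t); rewrite big_cat.
- by exists [:: (v, w)]; rewrite big_seq1.
Qed.

Lemma tlift_sum (U : lmodType k) (f : V -> W -> U)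
    (I : Type) (s : seq I) (v : I -> V) (w : I -> W) :
  bilinear_for *:%R *:%R f ->
  tlift f (\sum_(q <- s) v q ⊗ w q) = \sum_(q <- s) f (v q) (w q).
Proof.
move=> fb; rewrite (linear_fun_sum (tlift_linear fb)).
by apply: eq_bigr => q _; rewrite tliftE.
Qed.

(** Shortening a presentation of a tensor by a dependency among its left or
   right factors; a shortest presentation therefore has no dependency. *)
Lemma tens_independent (t : tens V W) :
  exists d (v : 'I_d -> V) (w : 'I_d -> W),
    [/\ t = \sum_i v i ⊗ w i, independent v & independent w].
Proof.
pose R d := exists (v : 'I_d -> V) (w : 'I_d -> W), t = \sum_i v i ⊗ w i.
have [d0 Rd0] : exists d, R d.
  have [s tE] := tens_sum t.
  exists (size s), (fun i => (nth (0, 0) s i).1), (fun i => (nth (0, 0) s i).2).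
  by rewrite tE (big_nth (0, 0)) big_mkord.
have ex : exists d, `[< R d >] by exists d0; apply/asboolP.
case: (ex_minnP ex) => d /asboolP [v [w tE]] dmin.
have short : ~ R d.-1 \/ d = 0%N.
  case: d {v w tE} dmin => [|d] dmin; [by right|left].
  by move=> /= /asboolP /dmin; rewrite ltnn.
exists d, v, w; split=> //.
- move=> c c0 i; apply: contrapT => /eqP ci.
  case: short => [short|d1]; last by move: i {ci}; rewrite d1 => -[].
  case: d v w tE {dmin} short c c0 i ci => [|d] v w tE short c c0 i ci.
    by case: i ci.
  apply: short => /=; exists (fun j => v (lift i j)).
  exists (fun j => w (lift i j) - (c (lift i j) / c i) *: w i).
  rewrite tE (bigD1_ord i) //=.
  have -> : v i = \sum_j (- (c (lift i j) / c i)) *: v (lift i j).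
    move: c0; rewrite (bigD1_ord i) //= => /(congr1 (fun x => (c i)^-1 *: x)).
    rewrite scaler0 scalerDr scalerA mulVf // scale1r => /eqP.
    rewrite addr_eq0 => /eqP ->; rewrite scaler_sumr -sumrN.
    by apply: eq_bigr => j _; rewrite scalerA scaleNr mulrC.
  rewrite (linear_fun_sum ((tensor_bilinear V W).1 (w i))) -big_split /=.
  apply: eq_bigr => j _.
  by rewrite /= -scaleNr tensDr tensZr tensZl addrC.
- move=> c c0 i; apply: contrapT => /eqP ci.
  case: short => [short|d1]; last by move: i {ci}; rewrite d1 => -[].
  case: d v w tE {dmin} short c c0 i ci => [|d] v w tE short c c0 i ci.
    by case: i ci.
  apply: short => /=.
  exists (fun j => v (lift i j) - (c (lift i j) / c i) *: v i).
  exists (fun j => w (lift i j)).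
  rewrite tE (bigD1_ord i) //=.
  have -> : w i = \sum_j (- (c (lift i j) / c i)) *: w (lift i j).
    move: c0; rewrite (bigD1_ord i) //= => /(congr1 (fun x => (c i)^-1 *: x)).
    rewrite scaler0 scalerDr scalerA mulVf // scale1r => /eqP.
    rewrite addr_eq0 => /eqP ->; rewrite scaler_sumr -sumrN.
    by apply: eq_bigr => j _; rewrite scalerA scaleNr mulrC.
  rewrite (linear_fun_sum ((tensor_bilinear V W).2 (v i))) -big_split /=.
  apply: eq_bigr => j _.
  by rewrite /= -scaleNr tensDl tensZr tensZl addrC.
Qed.

Lemma tens_contractl (I : Type) (s : seq I) (v : I -> V) (w : I -> W)
    (f : V -> k) : scalar f ->
  \sum_(i <- s) v i ⊗ w i = 0 -> \sum_(i <- s) f (v i) *: w i = 0.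
Proof.
move=> fl E; pose F v w := f v *: w : W.
have Fb : bilinear_for *:%R *:%R F.
  split=> u c x y; rewrite /F /=.
    by rewrite fl scalerDl scalerA.
  by rewrite scalerDr !scalerA mulrC.
by rewrite -(tlift_sum s v w Fb) E (tlift0 Fb).
Qed.

Lemma tens_independent_eq0 d (v : 'I_d -> V) (w : 'I_d -> W) :
  independent v -> \sum_i v i ⊗ w i = 0 -> forall i, w i = 0.
Proof.
move=> vi E i; have [f [fl fv]] := coordinate_functional vi i.
have := tens_contractl fl E; rewrite (bigD1 i) //= fv eqxx scale1r big1 ?addr0 //.
by move=> j /negPf ji; rewrite fv ji scale0r.
Qed.

End Tensors.

Section TensorMaps.
Variables (k : fieldType) (V W V' W' : lmodType k) (f : V -> V') (g : W -> W').
Hypotheses (fl : linear f) (gl : linear g).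

Lemma tmap_bilinear :
  bilinear_for *:%R *:%R (fun v w => f v ⊗ g w).
Proof.
by split=> u c x y /=; rewrite (fl, gl) ?(tensDl, tensDr, tensZl, tensZr).
Qed.

Lemma tmap_linear : linear (tmap f g).
Proof. exact: tlift_linear tmap_bilinear. Qed.

Lemma tmap_sum (I : Type) (s : seq I) (v : I -> V) (w : I -> W) :
  tmap f g (\sum_(q <- s) v q ⊗ w q) = \sum_(q <- s) f (v q) ⊗ g (w q).
Proof. exact: tlift_sum tmap_bilinear. Qed.

End TensorMaps.

(** * Sweedler sums and the antipode *)

Lemma comul_sum (k : fieldType) (A : hopfAlgType k) (a : A) :
  exists s : seq (A * A), comul a = \sum_(q <- s) q.1 ⊗ q.2.
Proof. exact: tens_sum. Qed.

(** A choice of Sweedler summands: the sum of [f q.1 q.2] over [q <- cop a] is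
   what is written as the sum of the [f(a_1, a_2)]; by [cop_ext] it does not
   depend on the choice when [f] is bilinear. *)
Definition cop (k : fieldType) (A : hopfAlgType k) (a : A) : seq (A * A) :=
  projT1 (cid (comul_sum a)).

Definition trilinear (k : fieldType) (A U : lmodType k) (f : A -> A -> A -> U) :=
  [/\ forall y z, linear (fun x => f x y z),
      forall x z, linear (fun y => f x y z) &
      forall x y, linear (fun z => f x y z)].

Section Sweedler.
Variables (k : fieldType) (A : hopfAlgType k).
Implicit Types (a b : A) (U : lmodType k).

Lemma copE a : comul a = \sum_(q <- cop a) q.1 ⊗ q.2.
Proof. by rewrite /cop; case: cid. Qed.

Lemma tlift_comul U (f : A -> A -> U) a : bilinear_for *:%R *:%R f ->
  tlift f (comul a) = \sum_(q <- cop a) f q.1 q.2.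
Proof. by move=> fb; rewrite copE tlift_sum. Qed.

Lemma cop_ext U (f : A -> A -> U) (I : Type) (s : seq I) (u v : I -> A) a :
    bilinear_for *:%R *:%R f -> comul a = \sum_(i <- s) u i ⊗ v i ->
  \sum_(q <- cop a) f q.1 q.2 = \sum_(i <- s) f (u i) (v i).
Proof. by move=> fb E; rewrite -tlift_comul // E tlift_sum. Qed.

Lemma cop_linear U (f : A -> A -> U) : bilinear_for *:%R *:%R f ->
  linear (fun a => \sum_(q <- cop a) f q.1 q.2).
Proof.
move=> fb c a b; rewrite -!tlift_comul // comul_linear.
exact: (tlift_linear fb).
Qed.

Lemma cop_mul U (f : A -> A -> U) a b : bilinear_for *:%R *:%R f ->
  \sum_(q <- cop (a * b)) f q.1 q.2 =
  \sum_(q <- cop a) \sum_(r <- cop b) f (q.1 * r.1) (q.2 * r.2).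
Proof.
move=> fb; rewrite -tlift_comul // (comul_monoid_morphism : monoid_morphism _).2.
rewrite (copE a) (copE b) mulr_suml (linear_fun_sum (tlift_linear fb)).
apply: eq_bigr => q _; rewrite mulr_sumr (linear_fun_sum (tlift_linear fb)).
apply: eq_bigr => r _.
have -> : (q.1 ⊗ q.2) * (r.1 ⊗ r.2) = (q.1 * r.1) ⊗ (q.2 * r.2) by exact: tens_mulE.
by rewrite tliftE.
Qed.

Lemma cop1 U (f : A -> A -> U) : bilinear_for *:%R *:%R f ->
  \sum_(q <- cop (1 : A)) f q.1 q.2 = f 1 1.
Proof.
move=> fb; rewrite -tlift_comul // (comul_monoid_morphism : monoid_morphism _).1.
exact: tliftE.
Qed.

Lemma cop_assoc U (f : A -> A -> A -> U) a : trilinear f ->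
  \sum_(q <- cop a) \sum_(r <- cop q.1) f r.1 r.2 q.2 =
  \sum_(q <- cop a) \sum_(r <- cop q.2) f q.1 r.1 r.2.
Proof.
move=> [f1 f2 f3].
have fx x : bilinear_for *:%R *:%R (f x) by split=> u c y z /=; rewrite ?f2 ?f3.
pose T := tlift (fun x (s : tens A A) => tlift (f x) s).
have Tb : bilinear_for *:%R *:%R (fun x (s : tens A A) => tlift (f x) s).
  split=> u c y z /=; last exact: (tlift_linear (fx u)).
  have [s ->] := tens_sum u; rewrite !tlift_sum //.
  rewrite scaler_sumr -big_split /=; apply: eq_bigr => q _; exact: f1.
have idl : linear (id : A -> A) by [].
have Al (w : A) : bilinear_for *:%R *:%R (fun u v : A => u ⊗ (v ⊗ w)).
  by split=> u c y z /=; rewrite ?(tensDl, tensDr, tensZl, tensZr).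
have Aw : bilinear_for *:%R *:%R (fun (s : tens A A) (w : A) =>
    tlift (fun u v : A => u ⊗ (v ⊗ w)) s).
  split=> u c y z /=; first exact: (tlift_linear (Al u)).
  have [s ->] := tens_sum u; rewrite !tlift_sum //.
  rewrite scaler_sumr -big_split /=; apply: eq_bigr => q _.
  by rewrite ?(tensDl, tensDr, tensZl, tensZr).
have := congr1 T (comulA a).
rewrite (copE a) (tmap_sum (@comul_linear _ A) idl) (tmap_sum idl (@comul_linear _ A)).
rewrite /tassoc tlift_sum // /T.
rewrite (linear_fun_sum (tlift_linear Tb)) tlift_sum //.
move=> E; rewrite [RHS](eq_bigr (fun q => tlift (f q.1) (comul q.2))); last first.
  by move=> q _; rewrite tlift_comul.
rewrite -E; apply: eq_bigr => q _; rewrite (copE q.1) tlift_sum //.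
rewrite (linear_fun_sum (tlift_linear Tb)); apply: eq_bigr => r _.
by rewrite tliftE // tliftE.
Qed.

Lemma counitL c a b : counit (c *: a + b) = c * counit a + counit b.
Proof. exact: counit_scalar. Qed.

Lemma sum_counitl U (f : A -> U) a : linear f ->
  \sum_(q <- cop a) counit q.1 *: f q.2 = f a.
Proof.
move=> fl; rewrite -{2}(counitl a) tlift_comul; last first.
  split=> u c x y /=.
    by rewrite counitL scalerDl scalerA.
  by rewrite scalerDr !scalerA mulrC.
rewrite (linear_fun_sum fl); apply: eq_bigr => q _.
by rewrite (linear_funZ fl).
Qed.

Lemma sum_counitr U (f : A -> U) a : linear f ->
  \sum_(q <- cop a) counit q.2 *: f q.1 = f a.
Proof.
move=> fl; rewrite -{2}(counitr a) tlift_comul; last first.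
  split=> u c x y /=.
    by rewrite scalerDr !scalerA mulrC.
  by rewrite counitL scalerDl scalerA.
rewrite (linear_fun_sum fl); apply: eq_bigr => q _.
by rewrite (linear_funZ fl).
Qed.

Notation S := (@antipode k A).

Lemma sum_antipodel a : \sum_(q <- cop a) S q.1 * q.2 = (counit a)%:A.
Proof.
rewrite -antipodel tlift_comul //.
by split=> u c x y /=; rewrite ?antipode_linear ?(mulrDl, mulrDr) -?scalerAl -?scalerAr.
Qed.

Lemma sum_antipoder a : \sum_(q <- cop a) q.1 * S q.2 = (counit a)%:A.
Proof.
rewrite -antipoder tlift_comul //.
by split=> u c x y /=; rewrite ?antipode_linear ?(mulrDl, mulrDr) -?scalerAl -?scalerAr.
Qed.

(** The uniqueness of two-sided inverses in a monoid, for the convolution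
   product of maps to the algebra [A ⊗ A]. *)
Lemma convolution_inverse_unique (f g h : A -> tens A A) :
    linear f -> linear g -> linear h ->
    (forall a, \sum_(q <- cop a) f q.1 * g q.2 = counit a *: (1 : tens A A)) ->
    (forall a, \sum_(q <- cop a) g q.1 * h q.2 = counit a *: (1 : tens A A)) ->
  f =1 h.
Proof.
move=> fl gl hl fg gh a.
have Ml (x y z : tens A A) c : (c *: x + y) * z = c *: (x * z) + y * z.
  exact: tens_mul_linearl.
have Mr (x y z : tens A A) c : z * (c *: x + y) = c *: (z * x) + z * y.
  exact: tens_mul_linearr.
have ZM (x y : tens A A) c : (c *: x) * y = c *: (x * y).
  exact: linear_funZ (tens_mul_linearl y) c x.
have MZ (x y : tens A A) c : x * (c *: y) = c *: (x * y).
  exact: linear_funZ (tens_mul_linearr x) c y.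
rewrite -(sum_counitr a fl) -(sum_counitl a hl).
have Tf : trilinear (fun x y z => f x * g y * h z).
  by split=> u v c x y /=; rewrite ?fl ?gl ?hl ?(Ml, Mr).
rewrite (eq_bigr (fun q => \sum_(r <- cop q.2) f q.1 * g r.1 * h r.2)); last first.
  move=> q _; rewrite (eq_bigr (fun r => f q.1 * (g r.1 * h r.2))).
    by rewrite -mulr_sumr gh MZ mulr1.
  by move=> r _; rewrite mulrA.
rewrite -(cop_assoc a Tf); apply: eq_bigr => q _.
by rewrite -mulr_suml fg ZM mul1r.
Qed.

Lemma counitM a b : counit (a * b) = counit a * counit b.
Proof. exact: (counit_monoid_morphism : monoid_morphism _).2. Qed.

Lemma counit1 : counit (1 : A) = 1.
Proof. exact: (counit_monoid_morphism : monoid_morphism _).1. Qed.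

(** Both [S (a * b)] and [S b * S a] arise from
   [S(a_1 b_1) a_2 b_2 S(b_3) S(a_3)], by cancelling on one side or the
   other. *)
Lemma antipodeM a b : S (a * b) = S b * S a.
Proof.
have Sl := @antipode_linear k A.
pose F x y z := \sum_(r <- cop b) \sum_(t <- cop r.2)
  S (x * r.1) * (y * t.1) * (S t.2 * S z).
have E1 : \sum_(q <- cop a) \sum_(r <- cop q.2) F q.1 r.1 r.2 = S (a * b).
  rewrite -(sum_counitr a (f := fun x => S (x * b))); last first.
    by move=> c x y; rewrite mulrDl -scalerAl Sl.
  apply: eq_bigr => q _.
  rewrite (eq_bigr (fun r =>
    \sum_(t <- cop b) counit t.2 *: (S (q.1 * t.1) * r.1 * S r.2))); last first.
    move=> r _; apply: eq_bigr => t _.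
    rewrite (eq_bigr (fun u => (S (q.1 * t.1) * r.1) * (u.1 * S u.2) * S r.2)).
      by rewrite -mulr_suml -mulr_sumr sum_antipoder -scalerAr -scalerAl mulr1.
    by move=> u _; rewrite !mulrA.
  rewrite exchange_big /= -(sum_counitr b (f := fun x => S (q.1 * x))); last first.
    by move=> c x y; rewrite mulrDr -scalerAr Sl.
  rewrite scaler_sumr; apply: eq_bigr => t _.
  rewrite -scaler_sumr scalerA mulrC -scalerA; congr (_ *: _).
  rewrite (eq_bigr (fun r => S (q.1 * t.1) * (r.1 * S r.2))).
    by rewrite -mulr_sumr sum_antipoder -scalerAr mulr1.
  by move=> r _; rewrite mulrA.
have FT : trilinear F.
  split=> u v; rewrite /F; apply: sum_linear => r; apply: sum_linear => t c x y;
  by rewrite ?(mulrDl, mulrDr, =^~ scalerAl, =^~ scalerAr, Sl).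
rewrite -E1 -(cop_assoc a FT) -(sum_counitl a (f := fun x => S b * S x)); last first.
  by move=> c x y; rewrite Sl mulrDr -scalerAr.
apply: eq_bigr => q _; rewrite /F exchange_big /=.
have GT : trilinear (fun x y z =>
    \sum_(i <- cop q.1) S (i.1 * x) * (i.2 * y) * (S z * S q.2)).
  split=> u v; apply: sum_linear => i; move=> c x y;
  by rewrite ?(mulrDl, mulrDr, =^~ scalerAl, =^~ scalerAr, Sl).
under eq_bigr do rewrite exchange_big /=.
rewrite -(cop_assoc b GT).
rewrite -(sum_counitl b (f := fun x => S x * S q.2)); last first.
  by move=> c x y; rewrite Sl mulrDl -scalerAl.
rewrite scaler_sumr; apply: eq_bigr => r _.
rewrite exchange_big /=.
under eq_bigr do rewrite -mulr_suml.
rewrite -mulr_suml scalerA -counitM -(cop_mul _ _ (f := fun x y => S x * y)) /=; last first.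
  by split=> u c x y /=; rewrite ?(mulrDl, mulrDr, =^~ scalerAl, =^~ scalerAr, Sl).
by rewrite sum_antipodel -scalerAl mul1r.
Qed.

Lemma counit_antipode a : counit (S a) = counit a.
Proof.
have Sl := @antipode_linear k A.
have := congr1 (@counit k A) (sum_antipodel a).
rewrite -[_%:A]addr0 counitL counit1 mulr1.
have -> : counit (0 : A) = 0.
  by have := counitL (-1) 0 (0 : A); rewrite scaler0 addr0 mulN1r addNr.
rewrite addr0 => <-.
rewrite -{1}(sum_counitr a Sl).
have El : linear (@counit k A : A -> k^o) by exact: counit_scalar.
rewrite !(linear_fun_sum El); apply: eq_bigr => q _.
by rewrite (linear_funZ El) counitM mulrC.
Qed.

(** Both sides are convolution inverses of [comul]. *)
Lemma comul_antipode a :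
  comul (S a) = \sum_(q <- cop a) S q.2 ⊗ S q.1.
Proof.
have Sl := @antipode_linear k A.
pose T := fun a : A => \sum_(q <- cop a) S q.2 ⊗ S q.1.
have Sb : bilinear_for *:%R *:%R (fun x y : A => S y ⊗ S x).
  by split=> u c x y /=; rewrite Sl ?(tensDl, tensDr, tensZl, tensZr).
apply: (convolution_inverse_unique (f := fun a => comul (S a)) (g := @comul _ A)
  (h := T)) a.
- by move=> c x y; rewrite Sl comul_linear.
- exact: comul_linear.
- exact: (cop_linear Sb).
- move=> a; have DM := (@comul_monoid_morphism k A : monoid_morphism _).2.
  under eq_bigr do rewrite -DM.
  rewrite -(linear_fun_sum (@comul_linear _ A)) sum_antipodel.
  rewrite (linear_funZ (@comul_linear _ A)).
  by rewrite (@comul_monoid_morphism k A : monoid_morphism _).1.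
- move=> a.
  have FT : trilinear (fun x y z : A => \sum_(t <- cop z) (x * S t.2) ⊗ (y * S t.1)).
    split=> u v; try (apply: sum_linear => t c x y;
      by rewrite ?(mulrDl, mulrDr, =^~ scalerAl, =^~ scalerAr)
      ?(tensDl, tensDr, tensZl, tensZr)).
    apply: (cop_linear (f := fun x y => (u * S y) ⊗ (v * S x))).
    by split=> w c x y /=; rewrite Sl ?(mulrDl, mulrDr, =^~ scalerAl, =^~ scalerAr)
      ?(tensDl, tensDr, tensZl, tensZr).
  transitivity (\sum_(q <- cop a) \sum_(r <- cop q.1) \sum_(t <- cop q.2)
      (r.1 * S t.2) ⊗ (r.2 * S t.1)).
    apply: eq_bigr => q _; rewrite (copE q.1) /T mulr_suml.
    apply: eq_bigr => r _; rewrite mulr_sumr; apply: eq_bigr => t _.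
    exact: tens_mulE.
  rewrite (cop_assoc a FT).
  transitivity (\sum_(q <- cop a) (q.1 * S q.2) ⊗ (1 : A)); last first.
    rewrite -(linear_fun_sum ((tensor_bilinear A A).1 1)) sum_antipoder tensZl.
    by [].
  apply: eq_bigr => q _.
  have GT : trilinear (fun x y z : A => (q.1 * S z) ⊗ (x * S y)).
    by split=> u v c x y /=; rewrite ?Sl ?(mulrDl, mulrDr, =^~ scalerAl, =^~ scalerAr)
      ?(tensDl, tensDr, tensZl, tensZr).
  rewrite -(cop_assoc q.2 GT).
  have Gl : linear (fun x => (q.1 * S x) ⊗ (1 : A)).
    by move=> c x y; rewrite Sl mulrDr -scalerAr tensDl tensZl.
  rewrite -(sum_counitl q.2 Gl); apply: eq_bigr => r _.
  rewrite -(linear_fun_sum ((tensor_bilinear A A).2 (q.1 * S r.2))).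
  by rewrite sum_antipoder tensZr.
Qed.

End Sweedler.

(** * Injectivity of the antipode *)

Definition one_sided_inverses_agree (M : pzRingType) :=
  forall x y : M, x * y = 1 -> y * x = 1.

(** Square matrices over matrices over a commutative ring are larger matrices
   over this ring, where determinants decide invertibility. *)
Lemma matrices_one_sided_inverses (R : nzRingType) m d :
  embeds_in_matrices R m -> one_sided_inverses_agree 'M[R]_d.
Proof.
move=> [C [f finj]] X Y XY.
pose G (X : 'M[R]_d) := \mxblock_(i < d, j < d) f (X i j).
have GM X' Y' : G (X' * Y') = G X' *m G Y'.
  rewrite mul_mxblock; apply/eq_mxblockP => i j.
  rewrite mxE raddf_sum /=; apply: eq_bigr => l _; exact: rmorphM.
have G1 : G 1 = 1%:M.
  rewrite -mxdiagZ; apply/eq_mxblockP => i j; rewrite mxE.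
  have [_|_] := eqVneq i j; last by rewrite raddf0.
  by rewrite conform_mx_id rmorph1.
have Ginj : injective G.
  move=> X' Y'; rewrite /G => /eq_mxblockP E; apply/matrixP => i j.
  exact/finj/E.
by apply: Ginj; rewrite GM G1; apply: mulmx1C; rewrite -GM XY G1.
Qed.

(** If one-sided inverses agree, they agree in the corner [q * M * q] as well:
   complete an element of the corner by [1 - q]. *)
Lemma inverse_stabilises (M : pzRingType) (q x y : M) :
    one_sided_inverses_agree M -> q * q = q -> x * y = 1 ->
  y * q = q * y * q -> x * q = q * x * q.
Proof.
move=> wf qq xy yq.
have yx := wf _ _ xy.
have [p [q1 q2 q3 qp]] : exists p, [/\ q * p = 0, p * q = 0, p * p = p & q + p = 1].
  exists (1 - q); split; last by rewrite addrC subrK.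
  - by rewrite mulrBr mulr1 qq subrr.
  - by rewrite mulrBl mul1r qq subrr.
  - by rewrite mulrBr mulr1 mulrBl mul1r qq subrr subr0.
have corner u v : (q * u * q + p) * (q * v * q + p) = q * u * q * v * q + p.
  rewrite mulrDl !mulrDr q3 -!mulrA q1 !mulr0 addr0 (mulrA p q) q2 mul0r add0r.
  by rewrite (mulrA q q) qq.
have E : (q * x * q + p) * (q * y * q + p) = 1.
  by rewrite corner -2!mulrA (mulrA q y) -yq mulrA -(mulrA q x) xy mulr1 qq.
have := wf _ _ E; rewrite corner -qp => /addIr H.
have {H} H : y * (q * (x * q)) = q.
  by rewrite -[RHS]H -yq !mulrA.
by rewrite -{1}H (mulrA x y) xy mul1r mulrA.
Qed.

(** The linear relations among the [w i] are the vectors fixed by an idempotent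
   matrix, a projection of the space of coefficients on the space of relations;
   with it the relations can be handled without choosing a basis of them. *)
Lemma relations_projection (k : fieldType) (V : lmodType k) d (w : 'I_d -> V) :
  exists P : 'M[k]_d, P *m P = P /\
    forall c : 'I_d -> k, \sum_i c i *: w i = 0 <->
      forall j, \sum_i c i * P i j = c j.
Proof.
pose F (c : 'rV[k]_d) := \sum_i c 0 i *: w i.
have Fl : linear F.
  move=> a c c'; rewrite /F scaler_sumr -big_split; apply: eq_bigr => i _ /=.
  by rewrite !mxE scalerDl scalerA.
pose R r := exists B : 'M[k]_d, \rank B = r /\ forall i, F (row i B) = 0.
have Fsub (m : nat) (B : 'M[k]_(m, d)) (c : 'rV_d) :
    (forall i, F (row i B) = 0) -> (c <= B)%MS -> F c = 0.
  move=> B0 /submxP [D ->]; rewrite mulmx_sum_row (linear_fun_sum Fl) big1 // => i _.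
  by rewrite (linear_funZ Fl) B0 scaler0.
have ex : exists r, `[< R r >].
  exists 0%N; apply/asboolP; exists 0; rewrite mxrank0; split=> // i.
  by rewrite row0 (linear_fun0 Fl).
have ub r : `[< R r >] -> (r <= d)%N.
  by move=> /asboolP [B [<- _]]; exact: rank_leq_row.
case: (ex_maxnP ex ub) => r /asboolP [B [Br B0]] rmax.
have FB (c : 'rV_d) : F c = 0 <-> (c <= B)%MS.
  split; last exact: Fsub.
  move=> c0; have le : (B <= B + c)%MS by exact: addsmxSl.
  have H : R (\rank (B + c)%MS).
    exists (B + c)%MS; split=> // i.
    apply: (Fsub _ (col_mx B c)); last by rewrite -addsmxE row_sub.
    move=> j; rewrite -[j]splitK; case: (split j) => l /=.
      by rewrite rowKu.
    by rewrite rowKd; have -> : row l c = c by apply/rowP => u; rewrite mxE ord1.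
  have /rmax : `[< R (\rank (B + c)%MS) >] by apply/asboolP.
  rewrite -Br => rle; apply: (submx_trans (addsmxSr B c)).
  by rewrite -(geq_leqif (mxrank_leqif_sup le)).
exists (pinvmx B *m B); split.
  by rewrite -mulmxA; congr (_ *m _); rewrite mulmxA mulmxKpV.
move=> c; pose cc := \row_i c i.
have -> : \sum_i c i *: w i = F cc by apply: eq_bigr => i _; rewrite mxE.
rewrite FB; have E j : \sum_i c i * (pinvmx B *m B) i j = (cc *m (pinvmx B *m B)) 0 j.
  by rewrite [RHS]mxE; apply: eq_bigr => i _; rewrite [cc 0 i]mxE.
split=> [sub j|H].
  by rewrite E mulmxA mulmxKpV // mxE.
have -> : cc = cc *m (pinvmx B *m B).
  by apply/rowP => j; rewrite -E H mxE.
by rewrite mulmxA submxMl.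
Qed.

Section AntipodeInjective.
Variables (k : fieldType) (A : hopfAlgType k).
Notation S := (@antipode k A).

(** In a shortest presentation of [comul a] as the sum of the [v i ⊗ y i], both
   families are independent. Coassociativity, read in the coordinates [y],
   shows that the [v i] span a comodule, and read in the coordinates [v], that
   its coefficients [X] are multiplied like the entries of a matrix. *)
Lemma comatrix (a : A) : exists d (v y : 'I_d -> A) (X : 'I_d -> 'I_d -> A),
  [/\ comul a = \sum_i v i ⊗ y i,
      forall j, comul (v j) = \sum_i v i ⊗ X i j,
      forall i j, comul (X i j) = \sum_l X i l ⊗ X l j &
      forall i j, counit (X i j) = (i == j)%:R].
Proof.
have [d [v [y [aE vi yi]]]] := tens_independent (comul a).
have [phi phiP] := choice (coordinate_functional yi).
have [psi psiP] := choice (coordinate_functional vi).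
have fL i c u w : phi i (c *: u + w) = c * phi i u + phi i w.
  by have [fl _] := phiP i; apply: fl.
have gL i c u w : psi i (c *: u + w) = c * psi i u + psi i w.
  by have [fl _] := psiP i; apply: fl.
pose X i j := \sum_(q <- cop (y i)) phi j q.2 *: q.1.
have sw (c d' : k) (V : lmodType k) (u : V) : c *: (d' *: u) = d' *: (c *: u).
  by rewrite !scalerA mulrC.
pose bil := (scalerDl, scalerDr, =^~ scalerA, tensDl, tensDr, tensZl, tensZr).
have vE j : comul (v j) = \sum_i v i ⊗ X i j.
  have T : trilinear (fun x y z : A => phi j z *: (x ⊗ y)).
    by split=> u w c x z /=; rewrite ?fL !bil ?(sw (phi _ _)).
  have := cop_assoc a T.
  rewrite (eq_bigr (fun q => phi j q.2 *: comul q.1)); last first.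
    by move=> q _; rewrite -scaler_sumr -copE.
  have B1 : bilinear_for *:%R *:%R (fun x y : A => phi j y *: comul x).
    by split=> u c x z /=; rewrite ?fL ?comul_linear !bil ?(sw (phi _ _)).
  rewrite (cop_ext B1 aE) (bigD1 j) //= (phiP j).2 eqxx scale1r big1 ?addr0; last first.
    by move=> i ij; rewrite (phiP j).2 (negPf ij) scale0r.
  move=> ->.
  have B3 (w : A) : bilinear_for *:%R *:%R (fun x y : A => phi j y *: (w ⊗ x)).
    by split=> u c x z /=; rewrite ?fL !bil ?(sw (phi _ _)).
  have B2 : bilinear_for *:%R *:%R
      (fun x y : A => \sum_(r <- cop y) phi j r.2 *: (x ⊗ r.1)).
    split=> u; last exact: (cop_linear (B3 u)).
    by apply: sum_linear => r c x z; rewrite !bil ?(sw (phi _ _)).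
  rewrite (cop_ext B2 aE); apply: eq_bigr => i _.
  rewrite (linear_fun_sum ((tensor_bilinear A A).2 (v i))).
  by apply: eq_bigr => q _; rewrite tensZr.
exists d, v, y, X; split=> // [l j|].
- have T : trilinear (fun x y z : A => psi l x *: (y ⊗ z)).
    by split=> u w c x z /=; rewrite ?gL !bil ?(sw (psi _ _)).
  have := cop_assoc (v j) T.
  rewrite [X in _ = X](eq_bigr (fun q => psi l q.1 *: comul q.2)); last first.
    by move=> q _; rewrite -scaler_sumr -copE.
  have B1 : bilinear_for *:%R *:%R (fun x y : A => psi l x *: comul y).
    by split=> u c x z /=; rewrite ?gL ?comul_linear !bil ?(sw (psi _ _)).
  rewrite (cop_ext B1 (vE j)) (bigD1 l) //= (psiP l).2 eqxx scale1r.
  rewrite [X in _ + X]big1 ?addr0; last first.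
    by move=> i il; rewrite (psiP l).2 (negPf il) scale0r.
  move=> <-.
  have B3 (w : A) : bilinear_for *:%R *:%R (fun x y : A => psi l x *: (y ⊗ w)).
    by split=> u c x z /=; rewrite ?gL !bil ?(sw (psi _ _)).
  have B2 : bilinear_for *:%R *:%R
      (fun x y : A => \sum_(r <- cop x) psi l r.1 *: (r.2 ⊗ y)).
    split=> u; first exact: (cop_linear (B3 u)).
    by apply: sum_linear => r c x z; rewrite !bil ?(sw (psi _ _)).
  rewrite (cop_ext B2 (vE j)); apply: eq_bigr => i _.
  rewrite (cop_ext (B3 _) (vE i)) (bigD1 l) //= (psiP l).2 eqxx scale1r.
  rewrite [X in _ + X]big1 ?addr0 // => m ml.
  by rewrite (psiP l).2 (negPf ml) scale0r.
- move=> i j.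
  have idl : linear (id : A -> A) by [].
  have := sum_counitr (v j) idl.
  have B : bilinear_for *:%R *:%R (fun x y : A => counit y *: x).
    by split=> u c x z /=; rewrite ?counitL !bil ?(sw (counit _)).
  rewrite (cop_ext B (vE j)) => E.
  have := vi (fun i => counit (X i j) - (i == j)%:R).
  rewrite (eq_bigr (fun i => counit (X i j) *: v i - (i == j)%:R *: v i)); last first.
    by move=> l _; rewrite scalerBl.
  rewrite sumrB E (bigD1 j) //= eqxx scale1r big1 ?addr0 ?subrr; last first.
    by move=> l /negPf ->; rewrite scale0r.
  by move=> /(_ erefl i) /eqP; rewrite subr_eq0 => /eqP.
Qed.

(** With [X] the comatrix of [a], the relations satisfied by the [S v_i] form
   a space that [S X], read as a matrix over [A], stabilises, because [S] is
   anticomultiplicative. The inverse [X] of [S X] then stabilises this space as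
   well, so that the kernel of [S] in the span of the [v_i] is a subcomodule;
   it is zero since [counit] vanishes on it. *)
Lemma antipode_injective m : embeds_in_matrices A m -> injective S.
Proof.
move=> emb; suff ker0 a : S a = 0 -> a = 0.
  move=> a b /eqP; rewrite -subr_eq0 -(linear_funB (@antipode_linear k A)) => /eqP.
  by move=> /ker0 /eqP; rewrite subr_eq0 => /eqP.
move=> Sa0.
have Sl := @antipode_linear k A.
have el : linear (@counit k A : A -> k^o) by exact: counit_scalar.
have sw (c d' : k) (V : lmodType k) (u : V) : c *: (d' *: u) = d' *: (c *: u).
  by rewrite !scalerA mulrC.
pose bil := (scalerDl, scalerDr, =^~ scalerA, tensDl, tensDr, tensZl, tensZr).
have idl : linear (id : A -> A) by [].
have Br : bilinear_for *:%R *:%R (fun x y : A => counit y *: x).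
  by split=> u c x z /=; rewrite ?counitL !bil ?(sw (counit _)).
have Bl : bilinear_for *:%R *:%R (fun x y : A => counit x *: y).
  by split=> u c x z /=; rewrite ?counitL !bil ?(sw (counit _)).
have Bm : bilinear_for *:%R *:%R (fun x y : A => x * S y).
  by split=> u c x z /=; rewrite ?Sl ?mulrDl ?mulrDr -?scalerAl -?scalerAr.
have Bt : bilinear_for *:%R *:%R (fun x y : A => S y ⊗ S x).
  by split=> u c x z /=; rewrite ?Sl !bil.
have [d [v [y [X [aE vE XE eX]]]]] := comatrix a.
have [P [PP Prel]] := relations_projection (fun i => S (v i)).
have Prow l : \sum_i P l i *: S (v i) = 0.
  by apply/Prel => j; rewrite -[in RHS]PP mxE.
pose MX : 'M[A]_d := \matrix_(i, j) X i j.
pose SX : 'M[A]_d := \matrix_(i, j) S (X i j).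
pose Q : 'M[A]_d := \matrix_(i, j) (P j i)%:A.
have MS : MX * SX = 1.
  apply/matrixP => i j; rewrite !mxE.
  transitivity ((counit (X i j))%:A : A); last by rewrite eX scaler_nat.
  rewrite -sum_antipoder (cop_ext Bm (XE i j)).
  by apply: eq_bigr => l _; rewrite !mxE.
have QQ : Q * Q = Q.
  apply/matrixP => i j; rewrite !mxE -[in RHS]PP mxE scaler_suml.
  apply: eq_bigr => l _; rewrite !mxE -scalerAl mul1r scalerA mulrC.
  by rewrite mulrC.
have comul_span (c : 'I_d -> k) : comul (\sum_j c j *: v j) =
    \sum_i v i ⊗ (\sum_j c j *: X i j).
  rewrite (linear_fun_sum (@comul_linear _ A)).
  rewrite (eq_bigr (fun j => \sum_i v i ⊗ (c j *: X i j))).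
    rewrite exchange_big; apply: eq_bigr => i _ /=.
    by rewrite (linear_fun_sum ((tensor_bilinear A A).2 (v i))).
  move=> j _; rewrite (linear_funZ (@comul_linear _ A)) vE scaler_sumr.
  by apply: eq_bigr => i _; rewrite tensZr.
have SQ : SX * Q = Q * SX * Q.
  rewrite -mulrA; apply/matrixP => j l.
  pose x i := \sum_j P l j *: X i j.
  have xE i : (SX * Q) i l = S (x i).
    rewrite mxE /x (linear_fun_sum Sl); apply: eq_bigr => t _.
    by rewrite !mxE -scalerAr mulr1 (linear_funZ Sl).
  have rel : \sum_i S (x i) ⊗ S (v i) = 0.
    rewrite -(cop_ext Bt (comul_span (P l))) -comul_antipode.
    rewrite (linear_fun_sum Sl).
    rewrite (eq_bigr _ (fun i _ => linear_funZ Sl _ _)) Prow.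
    exact: linear_fun0 (@comul_linear _ A).
  rewrite xE mxE.
  apply/eqP; rewrite -subr_eq0; apply/eqP/functional_separates => f fl.
  have fl' : linear (f : A -> k^o) by exact: fl.
  rewrite (linear_funB fl') (linear_fun_sum fl').
  have := (Prel (fun i => f (S (x i)))).1 (tens_contractl fl rel) j.
  move=> <-; apply/eqP; rewrite subr_eq0; apply/eqP.
  apply: eq_bigr => i _; rewrite xE mxE -scalerAl mul1r (linear_funZ fl').
  by rewrite mulrC.
have XQ := inverse_stabilises (@matrices_one_sided_inverses A m d emb) QQ MS SQ.
pose c i := counit (y i).
have ac : a = \sum_i c i *: v i.
  by rewrite -[LHS](sum_counitr a idl) (cop_ext Br aE).
have cP : forall j, \sum_i c i * P i j = c j.
  apply/Prel; transitivity (S a) => //; rewrite ac (linear_fun_sum Sl).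
  by apply: eq_bigr => i _; rewrite (linear_funZ Sl).
pose x i := \sum_j c j *: X i j.
have xE i : x i = \sum_j P j i *: x j.
  have MQ u t : (MX * Q) u t = \sum_j P t j *: X u j.
    by rewrite mxE; apply: eq_bigr => j _; rewrite !mxE -scalerAr mulr1.
  have xQ u : x u = \sum_t c t *: (MX * Q) u t.
    rewrite /x; under eq_bigr do rewrite -cP scaler_suml.
    rewrite exchange_big; apply: eq_bigr => t _ /=.
    by rewrite MQ scaler_sumr; apply: eq_bigr => j _; rewrite scalerA.
  rewrite xQ XQ -mulrA.
  under [RHS]eq_bigr do rewrite xQ scaler_sumr.
  rewrite exchange_big; apply: eq_bigr => t _ /=.
  rewrite mxE scaler_sumr; apply: eq_bigr => j _.
  by rewrite mxE -scalerAl mul1r sw.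
have aE2 : a = \sum_i counit (v i) *: x i.
  rewrite -[LHS](sum_counitl a idl) (cop_ext Bl (s := index_enum _) (u := v) (v := x)) //.
  by rewrite {1}ac comul_span.
rewrite aE2; under eq_bigr do rewrite xE scaler_sumr.
rewrite exchange_big big1 // => j _ /=.
under eq_bigr do rewrite scalerA.
rewrite -scaler_suml.
have -> : \sum_i counit (v i) * P j i = 0; last by rewrite scale0r.
transitivity (counit (\sum_i P j i *: S (v i))).
  rewrite (linear_fun_sum el); apply: eq_bigr => i _.
  by rewrite (linear_funZ el) counit_antipode mulrC.
by rewrite Prow; apply: linear_fun0 el.
Qed.

End AntipodeInjective.

(** * Embedding a ring in matrices over a localised commutative subring *)

Section CommutativeSubring.
Variables (R : nzRingType) (C : set R).

Definition subring_pred : {pred R} := fun x => `[< C x >].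

Hypotheses (C1 : C 1) (CB : forall x y, C x -> C y -> C (x - y))
  (CM : forall x y, C x -> C y -> C (x * y))
  (CC : forall x y, C x -> C y -> x * y = y * x).

Fact subring_pred_closed : subring_closed subring_pred.
Proof.
split=> [|x y /asboolP Cx /asboolP Cy|x y /asboolP Cx /asboolP Cy];
  apply/asboolP; [exact: C1|exact: CB|exact: CM].
Qed.

HB.instance Definition _ := GRing.isSubringClosed.Build R subring_pred
  subring_pred_closed.

Record subring_type :=
  SubringElt { subring_val : R; _ : subring_val \in subring_pred }.

HB.instance Definition _ := [isSub for subring_val].
HB.instance Definition _ := [Choice of subring_type by <:].
HB.instance Definition _ := [SubChoice_isSubNzRing of subring_type by <:].

Fact subring_mulC : commutative (@GRing.mul subring_type).
Proof.
move=> [x Cx] [y Cy]; apply/val_inj; rewrite !rmorphM /=.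
by apply: CC; apply/asboolP.
Qed.

HB.instance Definition _ :=
  GRing.PzRing_hasCommutativeMul.Build subring_type subring_mulC.

Lemma commutative_subring : exists (C0 : comNzRingType) (g : {rmorphism C0 -> R}),
  injective g /\ forall x, C x -> exists c, g c = x.
Proof.
exists subring_type, (val : {rmorphism subring_type -> R}); split.
  exact: val_inj.
by move=> x /asboolP Cx; exists (SubringElt Cx).
Qed.

End CommutativeSubring.

Section Localisation.
Variables (R : comNzRingType) (t : R).
Hypothesis t_reg : forall x, x * t = 0 -> x = 0.

Definition localisation_ideal : {pred {poly R}} :=
  fun p => `[< exists q, p = q * (t *: 'X - 1) >].

(** The leading coefficient of a multiple of [t X - 1] is that of its
   cofactor multiplied by [t], which is regular. *)
Lemma constant_in_localisation_ideal c :
  c%:P \in localisation_ideal -> c = 0.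
Proof.
move=> /asboolP [q qE]; have [q0|q0] := eqVneq q 0.
  by move: qE; rewrite q0 mul0r => /eqP; rewrite polyC_eq0 => /eqP.
have := congr1 (fun p : {poly R} => p`_(size q)) qE.
rewrite coefC size_poly_eq0 (negPf q0) mulrBr mulr1 coefB [q`_(size q)]nth_default //.
rewrite subr0 -scalerAr coefZ coefMX size_poly_eq0 (negPf q0) -lead_coefE mulrC.
by move/esym/t_reg/eqP; rewrite lead_coef_eq0 (negPf q0).
Qed.

Fact localisation_idealr_closed : idealr_closed localisation_ideal.
Proof.
split.
- by apply/asboolP; exists 0; rewrite mul0r.
- apply/negP => /constant_in_localisation_ideal /eqP; by rewrite oner_eq0.
- move=> a x y /asboolP [q ->] /asboolP [r ->]; apply/asboolP.
  by exists (a * q + r); rewrite mulrDl mulrA.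
Qed.

HB.instance Definition _ := isIdealr.Build {poly R} localisation_ideal
  localisation_idealr_closed.

(** Adjoining an inverse of [t]: the quotient of the polynomial ring by the
   ideal of [t X - 1]. *)
Lemma localisation : exists (L : comNzRingType) (f : {rmorphism R -> L}) (u : L),
  injective f /\ f t * u = 1.
Proof.
pose L : comNzRingType := {ideal_quot (localisation_ideal : idealr _)}.
pose pr : {rmorphism {poly R} -> L} := \pi_L%qT.
have prP p q : (pr p = pr q) <-> (p - q \in localisation_ideal).
  by rewrite Quotient.idealrBE; split=> [->|/eqP].
pose f : {rmorphism R -> L} := pr \o polyC.
exists L, f, (pr 'X); split.
- move=> x y /prP; rewrite -polyCB => /constant_in_localisation_ideal /eqP.
  by rewrite subr_eq0 => /eqP.
- rewrite /= -rmorphM -(rmorph1 pr); apply/prP/asboolP; exists 1.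
  by rewrite mul1r mul_polyC.
Qed.

End Localisation.

(** [Pr i] is the projection to the [i]-th summand of a decomposition of [R]
   as a right module over the commutative subring [C]; this summand is freely
   generated by [b i] once the central element [t] is inverted. The matrix of
   the left multiplication by [a] has the entries [b' i * Pr i (a * b j) / t]. *)
Lemma embeds_in_matrices_of_basis (R : nzRingType) (C : set R) (e : nat)
    (b b' : 'I_e -> R) (t : R) (Pr : 'I_e -> R -> R) :
    C 1 -> (forall x y, C x -> C y -> C (x - y)) ->
    (forall x y, C x -> C y -> C (x * y)) ->
    (forall x y, C x -> C y -> x * y = y * x) ->
    (forall i x y, Pr i (x + y) = Pr i x + Pr i y) ->
    (forall a, \sum_i Pr i a = a) ->
    (forall i a c, C c -> Pr i (a * c) = Pr i a * c) ->
    (forall i a, C (b' i * Pr i a)) ->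
    C t -> (forall a, a * t = t * a) -> (forall a, a * t = 0 -> a = 0) ->
    (forall i, b i * b' i = t) -> (forall i, b' i * b i = t) ->
    (forall i j, Pr i (b j) = if i == j then b j else 0) ->
  embeds_in_matrices R e.
Proof.
move=> C1 CB CM CC PrD Prsum PrC bC Ct tC treg bb' b'b Prb.
have [C0 [g [ginj gC]]] := commutative_subring C1 CB CM CC.
have [t0 t0E] := gC _ Ct.
have t0reg x : x * t0 = 0 -> x = 0.
  move=> /(congr1 g); rewrite rmorphM rmorph0 t0E => /treg gx.
  by apply: ginj; rewrite gx rmorph0.
have [L [f [u [finj fu]]]] := localisation t0reg.
have [m mP] := choice (fun x : {x | C x} => gC (sval x) (svalP x)).
pose N a i j : C0 := m (exist _ _ (bC i (a * b j))).
have NE a i j : g (N a i j) = b' i * Pr i (a * b j) by rewrite mP.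
have fuM x : f (x * t0) * u = f x by rewrite rmorphM -mulrA fu mulr1.
have Pr0 i : Pr i 0 = 0.
  by apply: (addIr (Pr i 0)); rewrite -PrD !add0r.
have PrS i (I : Type) (r : seq I) (F : I -> R) :
    Pr i (\sum_(l <- r) F l) = \sum_(l <- r) Pr i (F l).
  exact: (big_morph (Pr i) (PrD i) (Pr0 i)).
have PrN i x : Pr i (- x) = - Pr i x.
  by apply/eqP; rewrite -addr_eq0 -PrD addNr Pr0.
have NB x y i j : N (x - y) i j = N x i j - N y i j.
  by apply: ginj; rewrite rmorphB !NE mulrBl PrD PrN mulrBr.
have N1 i j : N 1 i j = if i == j then t0 else 0.
  apply: ginj; rewrite NE mul1r Prb; case: eqP => [->|_].
    by rewrite b'b t0E.
  by rewrite mulr0 rmorph0.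
have NM x y i j : \sum_(l < e) N x i l * N y l j = N (x * y) i j * t0.
  apply: ginj; rewrite rmorph_sum rmorphM t0E NE.
  rewrite (eq_bigr (fun l => b' i * Pr i (x * t * Pr l (y * b j)))).
    rewrite -mulr_sumr -PrS -mulr_sumr Prsum -[RHS]mulrA -PrC //.
    by rewrite -(mulrA x) -(tC (y * b j)) !mulrA.
  move=> l _; rewrite rmorphM !NE -[LHS]mulrA -PrC //.
  by rewrite -[x * b l * _]mulrA [b l * _]mulrA bb' mulrA.
pose M a : 'M[L]_e := \matrix_(i, j) (f (N a i j) * u).
have MB : zmod_morphism M.
  by move=> x y; apply/matrixP => i j; rewrite !mxE NB rmorphB mulrBl.
have MM : monoid_morphism M.
  split=> [|x y]; apply/matrixP => i j; rewrite !mxE.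
    by rewrite N1; case: eqP => _; rewrite ?fu // rmorph0 mul0r.
  rewrite -[in LHS]fuM -NM rmorph_sum !mulr_suml; apply: eq_bigr => l _.
  by rewrite !mxE rmorphM mulrACA mulrA.
pose MA := GRing.isZmodMorphism.Build R 'M[L]_e M MB.
pose MR := GRing.isMonoidMorphism.Build R 'M[L]_e M MM.
pose h : {rmorphism R -> 'M[L]_e} := HB.pack M MA MR.
exists L, h; apply: raddf_inj => a a0.
have aN i j : N a i j = 0.
  have := congr1 (fun X : 'M_e => X i j * f t0) a0; rewrite !mxE mul0r -mulrA.
  rewrite (mulrC u) fu mulr1 => fN.
  by apply: finj; rewrite fN rmorph0.
have ab j : a * b j = 0.
  rewrite -[LHS]Prsum big1 // => i _; apply: treg.
  rewrite tC -(bb' i) -mulrA.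
  by rewrite -NE aN rmorph0 mulr0.
rewrite -[a]Prsum big1 // => j _.
suff -> : a = 0 by [].
by apply: treg; rewrite -(bb' j) mulrA ab mul0r.
Qed.

(** * Eigenspaces of an automorphism of finite order *)

(** Modulo [n], subtracting is adding [n.-1] times, so that a submonoid of [Z/n],
   given here by its preimage [P] in [nat], is stable under Euclidean division
   by its least positive element. *)
Lemma submonoid_mod (n : nat) (P : nat -> Prop) : (0 < n)%N -> P 0%N ->
    (forall i j, P i -> P j -> P (i + j)%N) ->
    (forall i j, i = j %[mod n] -> P i -> P j) ->
  exists e, [/\ (0 < e)%N, (e %| n)%N & forall i, P i <-> (e %| i)%N].
Proof.
move=> n0 P0 PD Pmod.
have Pn : P n by apply: (Pmod 0%N) => //; rewrite modnn mod0n.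
have ex : exists e, (0 < e)%N && `[< P e >].
  by exists n; rewrite n0; apply/asboolP.
case: (ex_minnP ex) => e /andP [e0 /asboolP Pe] emin.
have PM i m : P i -> P (i * m)%N.
  by move=> Pi; elim: m => [|m IH]; rewrite ?muln0 // mulnS; apply: PD.
have Pdvd i : P i -> (e %| i)%N.
  move=> Pi; rewrite /dvdn; apply/negPn/negP; rewrite -lt0n => r0.
  have : (e <= i %% e)%N.
    apply: emin; rewrite r0; apply/asboolP.
    (* the remainder is [i + (n - 1) q e] modulo [n], where [q = i %/ e] *)
    apply: (Pmod (i + e * (i %/ e * n.-1))%N); last by apply: PD => //; apply: PM.
    have -> : (i + e * (i %/ e * n.-1) = i %/ e * e * n + i %% e)%N.
      rewrite {1}(divn_eq i e) addnAC; congr (_ + _)%N.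
      by rewrite -[X in (_ = _ * X)%N](prednK n0) mulnS mulnA [(e * _)%N]mulnC.
    by rewrite modnMDl.
  by rewrite leqNgt ltn_pmod.
exists e; split=> // [|i]; first exact: Pdvd.
split; first exact: Pdvd.
by move=> /dvdnP [m ->]; rewrite mulnC; apply: PM.
Qed.

(** The eigenvalues of [l] are the powers of [w], so that its eigenspaces
   [degree w l i] form a grading by [Z/n], written with natural numbers [i]. *)
Record cyclic_action (k : fieldType) (A : algType k) (n : nat) (w : k)
    (l : A -> A) : Prop := CyclicAction {
  action_root : n.-primitive_root w;
  action_linear : linear l;
  actionM : forall x y, l (x * y) = l x * l y;
  action1 : l 1 = 1;
  action_order : forall a, iter n l a = a
}.

Definition degree (k : fieldType) (A : algType k) (w : k) (l : A -> A)
    (i : nat) : set A := [set a | l a = w ^+ i *: a].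

Section Eigenspaces.
Variables (k : fieldType) (A : algType k) (n : nat) (w : k) (l : A -> A).
Hypothesis act : cyclic_action n w l.
Local Notation deg := (degree w l).

Let ll := action_linear act.
Let n0 : (0 < n)%N := prim_order_gt0 (action_root act).
Let wn : w ^+ n = 1 := prim_expr_order (action_root act).
Let w0 : w != 0.
Proof. by apply/eqP => w0; move/eqP: wn; rewrite w0 expr0n gtn_eqF // eq_sym oner_eq0. Qed.

Lemma degreeL i c x y : deg i x -> deg i y -> deg i (c *: x + y).
Proof. by rewrite /degree /= => hx hy; rewrite ll hx hy scalerDr !scalerA mulrC. Qed.

Lemma degree0 i : deg i 0.
Proof. by rewrite /degree /= (linear_fun0 ll) scaler0. Qed.

Lemma degreeZ i c x : deg i x -> deg i (c *: x).
Proof. by move=> hx; rewrite -[_ *: _]addr0; apply: degreeL => //; apply: degree0. Qed.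

Lemma degreeD i x y : deg i x -> deg i y -> deg i (x + y).
Proof. by move=> hx hy; rewrite -[x]scale1r; apply: degreeL. Qed.

Lemma degreeB i x y : deg i x -> deg i y -> deg i (x - y).
Proof. by move=> hx hy; rewrite addrC -scaleN1r; apply: degreeL. Qed.

Lemma degreeM i j x y : deg i x -> deg j y -> deg (i + j) (x * y).
Proof.
rewrite /degree /= => hx hy.
by rewrite (actionM act) hx hy -scalerAl -scalerAr scalerA -exprD.
Qed.

Lemma degree_one : deg 0 1.
Proof. by rewrite /degree /= (action1 act) expr0 scale1r. Qed.

Lemma degreeX i x m : deg i x -> deg (i * m) (x ^+ m).
Proof.
move=> hx; elim: m => [|m IH]; first by rewrite muln0 expr0; apply: degree_one.
by rewrite mulnS exprS; apply: degreeM.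
Qed.

Lemma degree_sum i (I : eqType) (r : seq I) (F : I -> A) :
  (forall q, q \in r -> deg i (F q)) -> deg i (\sum_(q <- r) F q).
Proof.
move=> H; rewrite big_seq; elim/big_ind: _ => //; first exact: degree0.
by move=> x y; apply: degreeD.
Qed.

Lemma degree_ext i j x : w ^+ i = w ^+ j -> deg i x -> deg j x.
Proof. by rewrite /degree /= => ->. Qed.

Lemma degree_iter i m x : deg i x -> iter m l x = w ^+ (i * m) *: x.
Proof.
move=> hx; elim: m => [|m IH]; first by rewrite muln0 expr0 scale1r.
by rewrite iterS IH (linear_funZ ll) hx scalerA -exprD mulnSr.
Qed.

Lemma iter_action_linear m : linear (iter m l).
Proof. by elim: m => [//|m IH] c x y; rewrite !iterS IH ll. Qed.

Lemma iter_actionM m x y : iter m l (x * y) = iter m l x * iter m l y.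
Proof. by elim: m => [//|m IH]; rewrite !iterS IH (actionM act). Qed.

Lemma iter_action1 m : iter m l 1 = 1.
Proof. by elim: m => [//|m IH]; rewrite !iterS IH (action1 act). Qed.

(** The projection to [degree w l i], as the isotypic projection of a cyclic
   group acting through the powers of [l]. *)
Definition component i (a : A) : A :=
  n%:R^-1 *: \sum_(m < n) w^-1 ^+ (i * m) *: iter m l a.

Lemma component_linear i : linear (component i).
Proof.
move=> c x y; rewrite /component scalerA mulrC -scalerA -scalerDr; congr (_ *: _).
rewrite scaler_sumr -big_split; apply: eq_bigr => m _ /=.
by rewrite iter_action_linear scalerDr !scalerA mulrC.
Qed.

Lemma component_degree i a : deg i (component i a).
Proof.
rewrite /degree /= /component (linear_funZ ll) scalerA mulrC -scalerA.
congr (_ *: _); rewrite (linear_fun_sum ll) scaler_sumr.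
pose G m := w^-1 ^+ (i * m) *: iter m l a.
rewrite (eq_bigr (fun m : 'I_n => w ^+ i *: G m.+1)); last first.
  move=> m _; rewrite (linear_funZ ll) /G iterS scalerA; congr (_ *: _).
  by rewrite mulnS exprD mulrA -exprMn divff // expr1n mul1r.
rewrite -!scaler_sumr; congr (_ *: _).
have Gn : G n = G 0%N.
  by rewrite /G (action_order act) muln0 mulnC exprM exprVn wn invr1 expr1n.
case: (n) n0 Gn => // p _ Gp.
by rewrite big_ord_recr [RHS]big_ord_recl /= Gp addrC.
Qed.

Lemma geometric_root (z : k) : z ^+ n = 1 -> z != 1 -> \sum_(m < n) z ^+ m = 0.
Proof.
move=> zn z1; have := subrX1 z n; rewrite zn subrr => /esym/eqP.
by rewrite mulf_eq0 subr_eq0 (negPf z1) => /eqP.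
Qed.

Lemma component_id i a : deg i a -> component i a = a.
Proof.
move=> ha; rewrite /component (eq_bigr (fun=> a)); last first.
  move=> m _; rewrite (degree_iter _ ha) scalerA -exprMn mulVf //.
  by rewrite expr1n scale1r.
rewrite sumr_const card_ord -[a *+ n]scaler_nat scalerA mulVf ?scale1r //.
exact: prim_root_natf_neq0 (action_root act).
Qed.

(** The powers of a root of unity different from [1] sum to zero. *)
Lemma component_neq i j a : deg j a -> w ^+ i != w ^+ j -> component i a = 0.
Proof.
move=> ha ij; rewrite /component (eq_bigr (fun m : 'I_n => (w ^+ j / w ^+ i) ^+ m *: a)).
  rewrite -scaler_suml geometric_root ?scale0r ?scaler0 //.
    by rewrite exprMn exprVn -!exprM ![(_ * n)%N]mulnC !exprM wn !expr1n invr1 mulr1.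
  apply: contra ij => /eqP E; apply/eqP.
  by rewrite -[LHS]mul1r -E mulfVK // expf_neq0.
move=> m _; rewrite (degree_iter _ ha) scalerA; congr (_ *: _).
by rewrite exprMn mulrC -exprVn -!exprM.
Qed.

Lemma component_sum a : \sum_(i < n) component i a = a.
Proof.
rewrite -scaler_sumr exchange_big /=.
rewrite (bigD1 (Ordinal n0)) //= [X in _ + X]big1 ?addr0; last first.
  move=> m m0; rewrite -scaler_suml.
  rewrite (eq_bigr (fun i : 'I_n => (w^-1 ^+ m) ^+ i)); last first.
    by move=> i _; rewrite mulnC exprM.
  rewrite geometric_root ?scale0r //.
    by rewrite -exprM mulnC exprM exprVn wn invr1 expr1n.
  rewrite exprVn invr_eq1 -(prim_order_dvd (action_root act)).
  by rewrite gtnNdvd // lt0n.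
rewrite (eq_bigr (fun=> a)); last by move=> i _; rewrite muln0 expr0 scale1r.
rewrite sumr_const card_ord -[a *+ n]scaler_nat scalerA mulVf ?scale1r //.
exact: prim_root_natf_neq0 (action_root act).
Qed.

Lemma degree_span (P : A -> Prop) : P 0 -> (forall x y, P x -> P y -> P (x + y)) ->
  (forall i a, (i < n)%N -> deg i a -> P a) -> forall a, P a.
Proof.
move=> P0 PD Pd a; rewrite -(component_sum a).
elim/big_ind: _ => // i _; apply: (Pd i) => //; exact: component_degree.
Qed.

Lemma degree_independent j (x : 'I_n -> A) : (forall i : 'I_n, deg (i + j) (x i)) ->
  \sum_i x i = 0 -> forall i, x i = 0.
Proof.
move=> xd x0 i; have := congr1 (component (i + j)) x0.
rewrite (linear_fun0 (component_linear _)) (linear_fun_sum (component_linear _)).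
rewrite (bigD1 i) //= (component_id (xd i)) big1 ?addr0 // => m mi.
apply: (component_neq (xd m)); apply: contra mi.
rewrite (eq_prim_root_expr (action_root act)) eqn_modDr.
by rewrite !modn_small // eq_sym.
Qed.

Lemma component_commute (f : A -> A) i : linear f -> (forall a, l (f a) = f (l a)) ->
  forall a, component i (f a) = f (component i a).
Proof.
move=> fl lf a; rewrite /component (linear_funZ fl) (linear_fun_sum fl).
congr (_ *: _); apply: eq_bigr => m _; rewrite (linear_funZ fl); congr (_ *: _).
by elim: (val m) => [//|p IH]; rewrite !iterS IH lf.
Qed.

End Eigenspaces.

(** * Strong gradings over a commutative domain *)

Record strong_grading (k : fieldType) (A : algType k) (n : nat) (w : k)
    (l : A -> A) : Prop := StrongGrading {
  grading_action : cyclic_action n w l;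
  grading_strong : forall i j, w ^+ (i + j) = 1 -> exists s : seq (A * A),
    (forall q, q \in s -> degree w l i q.1 /\ degree w l j q.2) /\
    \sum_(q <- s) q.1 * q.2 = 1;
  grading_comm : forall x y, degree w l 0 x -> degree w l 0 y -> x * y = y * x;
  grading_domain : forall x y, degree w l 0 x -> degree w l 0 y ->
    x * y = 0 -> x = 0 \/ y = 0
}.

Section StrongGrading.
Variables (k : fieldType) (A : algType k) (n : nat) (w : k) (l : A -> A).
Hypothesis gr : strong_grading n w l.
Local Notation deg := (degree w l).

Let act := grading_action gr.
Let n0 : (0 < n)%N := prim_order_gt0 (action_root act).
Let wn : w ^+ n = 1 := prim_expr_order (action_root act).
Let inv i := (i * n.-1)%N.

Let inv_r i : w ^+ (i + inv i) = 1.
Proof. by rewrite /inv -mulnS prednK // mulnC exprM wn expr1n. Qed.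

Let inv_l i : w ^+ (inv i + i) = 1.
Proof. by rewrite addnC inv_r. Qed.

Lemma degree_eq0 i j x : w ^+ (i + j) = 1 ->
  (forall v, deg j v -> v * x = 0) -> x = 0.
Proof.
move=> ij H; have [s [sd s1]] := grading_strong gr ij.
rewrite -[x]mul1r -s1 mulr_suml big_seq big1 // => q /sd [_ q2].
by rewrite -mulrA H // mulr0.
Qed.

Lemma degree_eq0r i j x : w ^+ (i + j) = 1 ->
  (forall v, deg i v -> x * v = 0) -> x = 0.
Proof.
move=> ij H; have [s [sd s1]] := grading_strong gr ij.
rewrite -[x]mulr1 -s1 mulr_sumr big_seq big1 // => q /sd [q1 _].
by rewrite mulrA H // mul0r.
Qed.

(** Multiplying by elements of the opposite degrees moves the product into
   degree zero, which is a domain. *)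
Lemma homogeneous_mul_eq0 i j a b : deg i a -> deg j b -> a * b = 0 ->
  a = 0 \/ b = 0.
Proof.
move=> ha hb ab; have [a0|a0] := pselect (a = 0); [by left|right].
have [v [hv va]] : exists v, deg (inv i) v /\ v * a <> 0.
  apply: contrapT => H; apply: a0; apply: (degree_eq0 (inv_r i)) => v hv.
  by apply: contrapT => va; apply: H; exists v.
apply: (degree_eq0r (inv_l j)) => u hu.
have hva : deg 0 (v * a).
  by apply: degree_ext (degreeM act hv ha); rewrite inv_l.
have hbu : deg 0 (b * u).
  by apply: degree_ext (degreeM act hb hu); rewrite inv_r.
have [|/va []|//] := grading_domain gr hva hbu.
by rewrite mulrA -(mulrA v) ab mulr0 mul0r.
Qed.

Lemma homogeneous_nonzero i : exists x, deg i x /\ x <> 0.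
Proof.
apply: contrapT => H; have := oner_eq0 A.
have -> : 1 = 0 :> A; last by rewrite eqxx.
apply: (degree_eq0 (inv_l i)) => v hv; rewrite mulr1.
by apply: contrapT => v0; apply: H; exists v.
Qed.

Lemma homogeneous_expr_neq0 i x m : deg i x -> x <> 0 -> x ^+ m <> 0.
Proof.
move=> hx x0; elim: m => [|m IH]; first by apply/eqP; rewrite expr0 oner_neq0.
rewrite exprS => E.
by have [] := homogeneous_mul_eq0 hx (degreeX act m hx) E.
Qed.

(** With [1] the sum of the [u * v] for some [u] of degree [i] and [v] of the
   opposite degree, [d'] is the sum of the [u * d * v]: the Miyashita action on
   the degree-zero component, which is commutative. *)
Lemma degree_twist i d : deg 0 d ->
  exists d', deg 0 d' /\ forall a, deg i a -> a * d = d' * a.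
Proof.
move=> hd; have [s [sd s1]] := grading_strong gr (inv_r i).
exists (\sum_(q <- s) q.1 * d * q.2); split.
  apply: (degree_sum act) => q /sd [h1 h2].
  apply: degree_ext (degreeM act (degreeM act h1 hd) h2).
  by rewrite addn0 inv_r.
move=> a ha; rewrite -{1}[a]mul1r -s1 !mulr_suml big_seq [RHS]big_seq.
apply: eq_bigr => q /sd [h1 h2].
have h : deg 0 (q.2 * a).
  by apply: degree_ext (degreeM act h2 ha); rewrite inv_l.
by rewrite -!mulrA (mulrA q.2) (grading_comm gr h hd).
Qed.

(** The twist of [c] can be read off on a single nonzero element. *)
Lemma commute_degree i c x : deg 0 c -> deg i x -> x <> 0 -> x * c = c * x ->
  forall a, deg i a -> a * c = c * a.
Proof.
move=> hc hx x0 xc a ha.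
have [c' [hc' H]] := degree_twist i hc.
rewrite (H _ ha); suff -> : c' = c by [].
have E : (c' - c) * x = 0 by rewrite mulrBl -H // xc subrr.
have [/eqP|//] := homogeneous_mul_eq0 (degreeB act hc' hc) hx E.
by rewrite subr_eq0 => /eqP.
Qed.

(** Components have rank one over the degree-zero component: [a] and [b] are
   proportional, with coefficients [b * v] and [a * v]. Both sides agree after
   multiplication by [v] on the left, because [v * a] and [v * b] commute. *)
Lemma degree_cross i j a b v : w ^+ (i + j) = 1 ->
  deg i a -> deg i b -> deg j v -> a * v * b = b * v * a.
Proof.
move=> ij ha hb hv.
have z x : deg i x -> deg 0 (v * x).
  by move=> hx; apply: degree_ext (degreeM act hv hx); rewrite addnC ij.
have h : deg i (a * v * b - b * v * a).
  have e : w ^+ (i + j + i) = w ^+ i by rewrite exprD ij mul1r.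
  by apply: (degreeB act); apply: (degree_ext e); do 2!apply: (degreeM act) => //.
have vx : v * (a * v * b - b * v * a) = 0.
  rewrite mulrBr !mulrA -(mulrA _ v b) -(mulrA _ v a).
  by rewrite (grading_comm gr (z _ ha) (z _ hb)) subrr.
have [->|/eqP] := homogeneous_mul_eq0 hv h vx.
- by rewrite !mulr0 !mul0r.
- by rewrite subr_eq0 => /eqP.
Qed.

(** A product with a homogeneous element shifts the components. *)
Lemma homogeneous_regular i t a : deg i t -> t <> 0 -> a * t = 0 -> a = 0.
Proof.
move=> ht t0; rewrite -(component_sum act a) mulr_suml => E.
have H : forall j : 'I_n, component n w l j a * t = 0.
  apply: (degree_independent act (j := i)) E => j.
  by apply: (degreeM act) => //; apply: (component_degree act).
rewrite big1 // => j _.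
by have [] := homogeneous_mul_eq0 (component_degree act j a) ht (H j).
Qed.

(** The degrees [i] such that [degree i] commutes with [degree 0] are the
   multiples of some [e] dividing [n]. The subring [C] of elements with such
   degrees is then commutative, by the rank-one property [degree_cross], and
   it is the ring of invariants of the iterate [n %/ e] of [l]. If [h] is
   nonzero of degree one, the powers [h ^+ i], [i < e], are a basis of [A] over
   [C] after inverting the central element [h ^+ n]; so [A] embeds in matrices
   of size [e]. *)
Lemma commuting_degree_eq0 :
    (forall m, embeds_in_matrices A m -> (n <= m)%N) ->
  forall i, (forall a d, deg i a -> deg 0 d -> a * d = d * a) -> w ^+ i = 1.
Proof.
move=> PImin.
pose P i := forall a d, deg i a -> deg 0 d -> a * d = d * a.
have degX0 x m i : deg i x -> w ^+ (i * m) = 1 -> deg 0 (x ^+ m).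
  by move=> hx im; apply: (degree_ext _ (degreeX act m hx)); rewrite im.
have [e [e0 en PE]] : exists e,
    [/\ (0 < e)%N, (e %| n)%N & forall i, P i <-> (e %| i)%N].
  apply: submonoid_mod => //.
  - by move=> a d ha hd; exact: (grading_comm gr ha hd).
  - move=> i j Pi Pj a d ha hd.
    have [x [hx x0]] := homogeneous_nonzero i.
    have [y [hy y0]] := homogeneous_nonzero j.
    have xy0 : x * y <> 0 by move=> /(homogeneous_mul_eq0 hx hy) [].
    apply: (commute_degree hd (degreeM act hx hy) xy0) ha.
    by rewrite -mulrA (Pj y) // !mulrA (Pi x).
  - move=> i j ij Pi a d ha hd; apply: Pi => //; apply: (degree_ext _ ha).
    by apply/esym/eqP; rewrite (eq_prim_root_expr (action_root act)) ij.
suff emb : embeds_in_matrices A e.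
  move=> i /PE ei; apply/eqP; rewrite -(prim_order_dvd (action_root act)).
  suff -> : n = e by [].
  by apply/eqP; rewrite eqn_leq PImin // dvdn_leq.
pose m := (n %/ e)%N; have emn : (e * m)%N = n by rewrite mulnC divnK.
pose la := iter m l; pose th := w ^+ m.
have act' : cyclic_action e th la.
  split.
  - exact: (dvdn_prim_root (action_root act) en).
  - exact: (iter_action_linear act m).
  - exact: (iter_actionM act m).
  - exact: (iter_action1 act m).
  - by move=> a; rewrite -(iterM e m) emn (action_order act).
pose C := degree th la 0.
have degC i a : deg i a -> (e %| i)%N -> C a.
  move=> ha /dvdnP [j ij]; rewrite /C /degree /= expr0 scale1r /la.
  rewrite (degree_iter act _ ha) ij -mulnA emn mulnC exprM wn expr1n.
  by rewrite scale1r.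
have Ccomp a i : C a -> component n w l i a = 0 \/ (e %| i)%N.
  move=> Ca.
  have E : la (component n w l i a) = component n w l i a.
    rewrite /la -(component_commute _ _ _ (iter_action_linear act m)).
      by congr (component _ _ _ _ _); move: Ca; rewrite /C /degree /= expr0 scale1r.
    by move=> b; rewrite -iterS iterSr.
  move: E; rewrite /la (degree_iter act _ (component_degree act i a)) => E.
  have /eqP : (w ^+ (i * m) - 1) *: component n w l i a = 0.
    by rewrite scalerBl scale1r E subrr.
  rewrite scaler_eq0 => /orP [|/eqP]; last by left.
  rewrite subr_eq0 -(prim_order_dvd (action_root act)) -emn dvdn_pmul2r; first by right.
  by rewrite divn_gt0 // dvdn_leq.
have [h [hh h0]] := homogeneous_nonzero 1.
have hd i : deg i (h ^+ i).
  by apply: (degree_ext _ (degreeX act i hh)); rewrite mul1n.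
have hn0 i : h ^+ i <> 0 := homogeneous_expr_neq0 hh h0.
(* [h ^+ i] generates [degree i] up to denominators in degree zero *)
have frac i a : deg i a ->
    exists d d', [/\ deg 0 d, deg 0 d', d <> 0 & d * a = d' * h ^+ i].
  move=> ha; have [v [hv v0]] := homogeneous_nonzero (inv i).
  have z x : deg i x -> deg 0 (x * v).
    by move=> hx; apply: (degree_ext _ (degreeM act hx hv)); rewrite inv_r.
  exists (h ^+ i * v), (a * v); split; [exact/z/hd|exact: z| |].
    by move=> /(homogeneous_mul_eq0 (hd i) hv) [/hn0|].
  exact: (degree_cross (inv_r i) (hd i) ha hv).
have homC i j a b : (e %| i)%N -> (e %| j)%N -> deg i a -> deg j b -> a * b = b * a.
  move=> /PE Pi /PE Pj ha hb.
  have [d [d' [hd0 hd' dN0 dE]]] := frac i a ha.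
  have [f [f' [hf0 hf' fN0 fE]]] := frac j b hb.
  have E1 : d * f * (a * b) = d' * f' * h ^+ (i + j).
    rewrite -mulrA (mulrA f) -(Pi a f) // -(mulrA a) fE mulrA dE.
    by rewrite -mulrA (mulrA _ f') (Pi _ f') // exprD !mulrA.
  have E2 : d * f * (b * a) = d' * f' * h ^+ (i + j).
    rewrite (grading_comm gr hd0 hf0) (grading_comm gr hd' hf').
    rewrite -mulrA (mulrA d) -(Pj b d) // -(mulrA b) dE mulrA fE.
    by rewrite -mulrA (mulrA _ d') (Pj _ d') // addnC exprD !mulrA.
  have hab : deg (i + j) (a * b - b * a).
    apply: (degreeB act); first exact: (degreeM act ha hb).
    by rewrite addnC; apply: (degreeM act).
  have df : deg 0 (d * f) by exact: (degreeM act hd0 hf0).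
  have [|/eqP|/eqP] := @homogeneous_mul_eq0 _ _ _ _ df hab.
  - by rewrite mulrBr E1 E2 subrr.
  - by move=> /eqP /(homogeneous_mul_eq0 hd0 hf0) [].
  - by rewrite subr_eq0 => /eqP.
have CC a b : C a -> C b -> a * b = b * a.
  move=> Ca Cb; rewrite -(component_sum act a) -(component_sum act b).
  rewrite mulr_suml mulr_sumr; apply: eq_bigr => i _.
  rewrite mulr_suml mulr_sumr; apply: eq_bigr => j _.
  have [->|ei] := Ccomp a i Ca; first by rewrite mul0r mulr0.
  have [->|ej] := Ccomp b j Cb; first by rewrite mul0r mulr0.
  exact: (homC _ _ _ _ ei ej (component_degree act i a) (component_degree act j b)).
pose t := h ^+ n.
have tD : deg 0 t by apply: degX0 hh _; rewrite mul1n wn.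
have tdeg i a : deg i a -> a * t = t * a.
  apply: (commute_degree tD (hd i) (hn0 i)).
  by rewrite /t -!exprD addnC.
have tC a : a * t = t * a.
  move: a; apply: (degree_span act); first by rewrite mul0r mulr0.
    by move=> x y hx hy; rewrite mulrDl mulrDr hx hy.
  by move=> i a _; apply: tdeg.
have th_n i : th ^+ (n - i + i) = 1 \/ (n < i)%N.
  have [ni|] := leqP i n; last by right.
  by left; rewrite subnK // -exprM mulnC exprM wn expr1n.
have thd i : degree th la i (h ^+ i).
  by rewrite /degree /= /la (degree_iter act _ (hd i)) -exprM mulnC.
have le_in (i : 'I_e) : (i <= n)%N.
  by apply: ltnW; apply: (leq_trans (ltn_ord i) _); apply: dvdn_leq.
apply: (@embeds_in_matrices_of_basis A C e (fun i => h ^+ i)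
  (fun i => h ^+ (n - i)) t (fun i => component e th la i)).
- exact: (degree_one act').
- exact: (@degreeB _ _ _ _ _ act' 0).
- exact: (@degreeM _ _ _ _ _ act' 0 0).
- exact: CC.
- by move=> i x y; rewrite (linear_funD (component_linear act' _)).
- exact: (component_sum act').
- move=> i a c Cc.
  apply: (component_commute _ _ _ (f := fun x => x * c)).
    by move=> u x y; rewrite mulrDl -scalerAl.
  move=> x; rewrite (actionM act').
  by move: Cc; rewrite /C /degree /= expr0 scale1r => ->.
- move=> i a; have [E|] := th_n i; last by rewrite ltnNge le_in.
  by apply: (degree_ext _ (degreeM act' (thd _) (component_degree act' i a))).
- by apply: (degC _ _ tD); rewrite dvdn0.
- exact: tC.
- by move=> a; apply: (homogeneous_regular (t := t) tD); apply: hn0.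
- by move=> i; rewrite -exprD subnKC.
- by move=> i; rewrite -exprD subnK.
- move=> i j; have [->|ij] := eqVneq i j.
    exact: (component_id act' (thd j)).
  apply: (component_neq act' (thd j)).
  rewrite (eq_prim_root_expr (action_root act')).
  by rewrite !modn_small.
Qed.

(** The components of a central element commute with the degree-zero component,
   hence so does all of the degree of any that does not vanish. *)
Lemma center_degree0 : (forall m, embeds_in_matrices A m -> (n <= m)%N) ->
  center A `<=` deg 0.
Proof.
move=> PImin z zC; rewrite -(component_sum act z).
apply: (degree_sum act) => i _.
have [->|zi] := pselect (component n w l i z = 0); first exact: degree0 act 0.
have zdeg := component_degree act i z.
apply: (degree_ext _ zdeg); rewrite expr0; apply: (commuting_degree_eq0 PImin).
move=> a d ha hd; apply: (commute_degree hd (component_degree act i z) zi) ha.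
have ld : l d = d by move: hd; rewrite /degree /= expr0 scale1r.
have lM : forall x, l (x * d) = l x * d by move=> x; rewrite (actionM act) ld.
have Ml : forall x, l (d * x) = d * l x by move=> x; rewrite (actionM act) ld.
have h1 := component_commute n w i (f := fun x => x * d) _ lM z.
have h2 := component_commute n w i (f := fun x => d * x) _ Ml z.
rewrite -h1; last by move=> u x y; rewrite mulrDl -scalerAl.
rewrite -h2; last by move=> u x y; rewrite mulrDr -scalerAr.
by rewrite (zC d).
Qed.

End StrongGrading.

(** * Winding maps *)

(** The maps [y ⊗ z |-> y z_1 ⊗ z_2] and [y ⊗ z |-> y S(z_1) ⊗ z_2] are inverse
   to each other, and the first one turns the multiplication of [z] by [x] on
   the right into the multiplication by [comul x] on the right. *)
Lemma comul_regular (k : fieldType) (A : hopfAlgType k) (x : A) :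
    (forall a, a * x = 0 -> a = 0) ->
  forall t : tens A A, t * comul x = 0 -> t = 0.
Proof.
move=> xreg t tx0; pose S := @antipode k A.
have Sl := @antipode_linear k A.
pose bil := (mulrDl, mulrDr, =^~ scalerAl, =^~ scalerAr, scalerDr,
  tensDl, tensDr, tensZl, tensZr).
pose f y z : tens A A := \sum_(q <- cop z) (y * q.1) ⊗ q.2.
pose g y z : tens A A := \sum_(q <- cop z) (y * S q.1) ⊗ q.2.
have fb : bilinear_for *:%R *:%R f.
  split=> u.
    by apply: sum_linear => q c a b; rewrite !bil.
  apply: (cop_linear (f := fun a b => (u * a) ⊗ b)).
  by split=> v c a b /=; rewrite !bil.
have gb : bilinear_for *:%R *:%R g.
  split=> u.
    by apply: sum_linear => q c a b; rewrite !bil.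
  apply: (cop_linear (f := fun a b => (u * S a) ⊗ b)).
  by split=> v c a b /=; rewrite ?/S ?Sl !bil.
have gf y z : tlift g (f y z) = y ⊗ z.
  rewrite /f tlift_sum // /g.
  have T : trilinear (fun a b c : A => (y * a * S b) ⊗ c).
    by split=> u v c a b /=; rewrite ?/S ?Sl !bil.
  rewrite -(cop_assoc z T).
  rewrite -(sum_counitl z (f := fun b => y ⊗ b)); last first.
    by move=> c a b; rewrite !bil.
  apply: eq_bigr => q _; rewrite -(linear_fun_sum ((tensor_bilinear A A).1 q.2)).
  rewrite -tensZl; congr (_ ⊗ _).
  under eq_bigr do rewrite -mulrA.
  by rewrite -mulr_sumr sum_antipoder -scalerAr mulr1.
have fg y z : tlift f (g y z) = y ⊗ z.
  rewrite /g tlift_sum // /f.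
  have T : trilinear (fun a b c : A => (y * S a * b) ⊗ c).
    by split=> u v c a b /=; rewrite ?/S ?Sl !bil.
  rewrite -(cop_assoc z T).
  rewrite -(sum_counitl z (f := fun b => y ⊗ b)); last first.
    by move=> c a b; rewrite !bil.
  apply: eq_bigr => q _; rewrite -(linear_fun_sum ((tensor_bilinear A A).1 q.2)).
  rewrite -tensZl; congr (_ ⊗ _).
  under eq_bigr do rewrite -mulrA.
  by rewrite -mulr_sumr sum_antipodel -scalerAr mulr1.
have fgK s : tlift f (tlift g s) = s.
  have [u ->] := tens_sum s; rewrite tlift_sum //.
  rewrite (linear_fun_sum (tlift_linear fb)).
  by apply: eq_bigr => q _.
have gfK s : tlift g (tlift f s) = s.
  have [u ->] := tens_sum s; rewrite tlift_sum //.
  rewrite (linear_fun_sum (tlift_linear gb)).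
  by apply: eq_bigr => q _.
have fx y z : f y (z * x) = f y z * comul x.
  have B : bilinear_for *:%R *:%R (fun a b : A => (y * a) ⊗ b).
    by split=> v c a b /=; rewrite !bil.
  rewrite /f (cop_mul z x B) [comul x]copE mulr_suml; apply: eq_bigr => q _.
  rewrite mulr_sumr; apply: eq_bigr => r _; rewrite mulrA; symmetry.
  exact: tens_mulE.
have [d [u [v [gE ui _]]]] := tens_independent (tlift g t).
have : \sum_i u i ⊗ (v i * x) = 0.
  rewrite -[LHS]gfK tlift_sum //.
  under eq_bigr do rewrite fx.
  rewrite -mulr_suml -(tlift_sum _ _ _ fb) -gE fgK tx0.
  exact: tlift0 gb.
move=> /(tens_independent_eq0 ui) vx.
rewrite -[t]fgK gE tlift_sum // big1 // => i _.
by rewrite (xreg (v i)) // (linear_fun0 (fb.2 (u i))).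
Qed.

Section Windings.
Variables (k : fieldType) (A : hopfAlgType k).
Implicit Types (f g : A -> k) (a : A).

Let bil := (scalerDl, scalerDr, =^~ scalerA, tensDl, tensDr, tensZl, tensZr).
Let sw (c d : k) (V : lmodType k) (u : V) : c *: (d *: u) = d *: (c *: u).
Proof. by rewrite !scalerA mulrC. Qed.

Section OneFunctional.
Variable f : A -> k.
Hypothesis fl : scalar f.

Let fL c x y : f (c *: x + y) = c * f x + f y.
Proof. exact: fl. Qed.

Lemma winding_l_bilinear (U : lmodType k) (h : A -> U) : linear h ->
  bilinear_for *:%R *:%R (fun x y => f x *: h y).
Proof.
by move=> hl; split=> u c x y /=; rewrite ?fL ?hl !bil // (sw (f u)).
Qed.

Lemma winding_r_bilinear (U : lmodType k) (h : A -> U) : linear h ->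
  bilinear_for *:%R *:%R (fun x y => f y *: h x).
Proof.
by move=> hl; split=> u c x y /=; rewrite ?fL ?hl !bil // (sw (f u)).
Qed.

Let idl : linear (id : A -> A). Proof. by []. Qed.

Lemma winding_lE a : winding_l f a = \sum_(q <- cop a) f q.1 *: q.2.
Proof. exact: tlift_comul (winding_l_bilinear idl). Qed.

Lemma winding_rE a : winding_r f a = \sum_(q <- cop a) f q.2 *: q.1.
Proof. exact: tlift_comul (winding_r_bilinear idl). Qed.

Lemma winding_l_linear : linear (winding_l f).
Proof.
move=> c x y; rewrite !winding_lE.
exact: (cop_linear (winding_l_bilinear idl)).
Qed.

Lemma winding_r_linear : linear (winding_r f).
Proof.
move=> c x y; rewrite !winding_rE.
exact: (cop_linear (winding_r_bilinear idl)).
Qed.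

Lemma comul_winding_l a :
  comul (winding_l f a) = tmap (winding_l f) id (comul a).
Proof.
rewrite (copE a) (tmap_sum winding_l_linear idl) winding_lE.
rewrite (linear_fun_sum (@comul_linear _ A)).
have T : trilinear (fun x y z : A => f x *: (y ⊗ z)).
  by split=> u v c x y /=; rewrite ?fL !bil ?(sw (f u)).
transitivity (\sum_(q <- cop a) \sum_(t <- cop q.2) f q.1 *: (t.1 ⊗ t.2)).
  apply: eq_bigr => q _; rewrite (linear_funZ (@comul_linear _ A)) (copE q.2).
  by rewrite scaler_sumr.
rewrite -(cop_assoc a T); apply: eq_bigr => q _.
rewrite winding_lE (linear_fun_sum ((tensor_bilinear A A).1 q.2)).
by apply: eq_bigr => t _; rewrite tensZl.
Qed.

Lemma comul_winding_r a :
  comul (winding_r f a) = tmap id (winding_r f) (comul a).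
Proof.
rewrite (copE a) (tmap_sum idl winding_r_linear) winding_rE.
rewrite (linear_fun_sum (@comul_linear _ A)).
have T : trilinear (fun x y z : A => f z *: (x ⊗ y)).
  by split=> u v c x y /=; rewrite ?fL !bil ?(sw (f _)).
transitivity (\sum_(q <- cop a) \sum_(t <- cop q.1) f q.2 *: (t.1 ⊗ t.2)).
  apply: eq_bigr => q _; rewrite (linear_funZ (@comul_linear _ A)) (copE q.1).
  by rewrite scaler_sumr.
rewrite (cop_assoc a T); apply: eq_bigr => q _.
rewrite winding_rE (linear_fun_sum ((tensor_bilinear A A).2 q.1)).
by apply: eq_bigr => t _; rewrite tensZr.
Qed.

Lemma tmap_winding_swap a :
  tmap (winding_r f) id (comul a) = tmap id (winding_l f) (comul a).
Proof.
rewrite (copE a) (tmap_sum idl winding_l_linear) (tmap_sum winding_r_linear idl).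
have T : trilinear (fun x y z : A => f y *: (x ⊗ z)).
  by split=> u v c x y /=; rewrite ?fL !bil ?(sw (f _)).
transitivity (\sum_(q <- cop a) \sum_(t <- cop q.1) f t.2 *: (t.1 ⊗ q.2)).
  apply: eq_bigr => q _.
  rewrite winding_rE (linear_fun_sum ((tensor_bilinear A A).1 q.2)).
  by apply: eq_bigr => t _; rewrite tensZl.
rewrite (cop_assoc a T); apply: eq_bigr => q _.
rewrite winding_lE (linear_fun_sum ((tensor_bilinear A A).2 q.1)).
by apply: eq_bigr => t _; rewrite tensZr.
Qed.

Lemma counit_winding_l a : counit (winding_l f a) = f a.
Proof.
have el : linear (@counit k A : A -> k^o) by exact: counit_scalar.
have fl' : linear (f : A -> k^o) by exact: fl.
rewrite winding_lE (linear_fun_sum el) -(sum_counitr a fl').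
by apply: eq_bigr => q _; rewrite (linear_funZ el) [LHS]mulrC.
Qed.

Lemma counit_winding_r a : counit (winding_r f a) = f a.
Proof.
have el : linear (@counit k A : A -> k^o) by exact: counit_scalar.
have fl' : linear (f : A -> k^o) by exact: fl.
rewrite winding_rE (linear_fun_sum el) -(sum_counitl a fl').
by apply: eq_bigr => q _; rewrite (linear_funZ el) [LHS]mulrC.
Qed.

End OneFunctional.

Lemma winding_commute f g a : scalar f -> scalar g ->
  winding_l f (winding_r g a) = winding_r g (winding_l f a).
Proof.
move=> fl gl.
have fL c x y : f (c *: x + y) = c * f x + f y by exact: fl.
have gL c x y : g (c *: x + y) = c * g x + g y by exact: gl.
have T : trilinear (fun x y z : A => (g z * f x) *: y).
  split=> u v c x y /=; rewrite ?fL ?gL ?mulrDl ?mulrDr ?scalerDl ?scalerDr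
    ?scalerA //; congr (_ *: _ + _).
  - by rewrite mulrCA.
  - by rewrite mulrC.
  - by rewrite mulrA.
rewrite (winding_rE gl) (winding_lE fl a).
rewrite (linear_fun_sum (winding_l_linear fl)) (linear_fun_sum (winding_r_linear gl)).
transitivity (\sum_(q <- cop a) \sum_(t <- cop q.1) (g q.2 * f t.1) *: t.2).
  apply: eq_bigr => q _.
  rewrite (linear_funZ (winding_l_linear fl)) (winding_lE fl) scaler_sumr.
  by apply: eq_bigr => t _; rewrite scalerA.
rewrite (cop_assoc a T); apply: eq_bigr => q _.
rewrite (linear_funZ (winding_r_linear gl)) (winding_rE gl) scaler_sumr.
by apply: eq_bigr => t _; rewrite scalerA mulrC.
Qed.

Lemma conv_bilinear f g : scalar f -> scalar g ->
  bilinear_for *:%R *:%R (fun x y => f x * g y : k^o).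
Proof.
move=> fl gl; split=> u c x y /=.
  by rewrite [f _]fl mulrDl -mulrA.
by rewrite [g _]gl mulrDr [c *: _]mulrCA.
Qed.

Lemma convE f g a : scalar f -> scalar g ->
  conv f g a = \sum_(q <- cop a) (f q.1 * g q.2 : k^o).
Proof. by move=> fl gl; apply: (tlift_comul _ (conv_bilinear fl gl)). Qed.

Lemma conv_scalar f g : scalar f -> scalar g -> scalar (conv f g).
Proof.
move=> fl gl c x y; rewrite !(convE _ fl gl).
exact: (cop_linear (conv_bilinear fl gl)).
Qed.

Lemma winding_l_comp f g a : scalar f -> scalar g ->
  winding_l f (winding_l g a) = winding_l (conv g f) a.
Proof.
move=> fl gl.
have fL c x y : f (c *: x + y) = c * f x + f y by exact: fl.
have gL c x y : g (c *: x + y) = c * g x + g y by exact: gl.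
have T : trilinear (fun x y z : A => (g x * f y) *: z).
  split=> u v c x y /=; rewrite ?fL ?gL ?mulrDl ?mulrDr ?scalerDl ?scalerDr ?scalerA //;
    congr (_ *: _ + _).
  - by rewrite mulrA.
  - by rewrite mulrCA.
  - by rewrite mulrC.
rewrite (winding_lE gl) (winding_lE (conv_scalar gl fl)).
rewrite (linear_fun_sum (winding_l_linear fl)).
transitivity (\sum_(q <- cop a) \sum_(t <- cop q.2) (g q.1 * f t.1) *: t.2).
  apply: eq_bigr => q _.
  rewrite (linear_funZ (winding_l_linear fl)) (winding_lE fl) scaler_sumr.
  by apply: eq_bigr => t _; rewrite scalerA.
rewrite -(cop_assoc a T); apply: eq_bigr => q _.
by rewrite (convE _ gl fl) scaler_suml.
Qed.

Lemma winding_r_comp f g a : scalar f -> scalar g ->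
  winding_r f (winding_r g a) = winding_r (conv f g) a.
Proof.
move=> fl gl.
have fL c x y : f (c *: x + y) = c * f x + f y by exact: fl.
have gL c x y : g (c *: x + y) = c * g x + g y by exact: gl.
have T : trilinear (fun x y z : A => (f y * g z) *: x).
  split=> u v c x y /=; rewrite ?fL ?gL ?mulrDl ?mulrDr ?scalerDl ?scalerDr ?scalerA //;
    congr (_ *: _ + _).
  - by rewrite mulrC.
  - by rewrite mulrA.
  - by rewrite mulrCA.
rewrite (winding_rE gl) (winding_rE (conv_scalar fl gl)).
rewrite (linear_fun_sum (winding_r_linear fl)).
transitivity (\sum_(q <- cop a) \sum_(t <- cop q.1) (f t.2 * g q.2) *: t.1).
  apply: eq_bigr => q _.
  rewrite (linear_funZ (winding_r_linear fl)) (winding_rE fl) scaler_sumr.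
  by apply: eq_bigr => t _; rewrite scalerA mulrC.
rewrite (cop_assoc a T); apply: eq_bigr => q _.
by rewrite (convE _ fl gl) scaler_suml.
Qed.

Lemma winding_l_counit a : winding_l (@counit k A) a = a.
Proof. by rewrite (winding_lE (@counit_scalar k A)) (sum_counitl a (f := id)). Qed.

Lemma winding_r_counit a : winding_r (@counit k A) a = a.
Proof. by rewrite (winding_rE (@counit_scalar k A)) (sum_counitr a (f := id)). Qed.

End Windings.

(** * Winding automorphisms of a character *)

Section Characters.
Variables (k : fieldType) (A : hopfAlgType k) (pi : {lrmorphism A -> k | *%R}).

Let pil : scalar pi. Proof. by move=> c x y; rewrite linearP. Qed.
Let piA c : pi c%:A = c.
Proof. by rewrite linearZ /= rmorph1 mulr1. Qed.
Let bil := (scalerDl, scalerDr, =^~ scalerA, tensDl, tensDr, tensZl, tensZr).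
Let sw (c d : k) (V : lmodType k) (u : V) : c *: (d *: u) = d *: (c *: u).
Proof. by rewrite !scalerA mulrC. Qed.

Notation l := (winding_l pi).
Notation r := (winding_r pi).
Notation S := (@antipode k A).

Lemma winding_lM x y : l (x * y) = l x * l y.
Proof.
rewrite !(winding_lE pil) (cop_mul x y (winding_l_bilinear pil (h := id) _)) //.
rewrite mulr_suml; apply: eq_bigr => q _; rewrite mulr_sumr.
by apply: eq_bigr => t _; rewrite rmorphM -scalerAl -scalerAr scalerA.
Qed.

Lemma winding_rM x y : r (x * y) = r x * r y.
Proof.
rewrite !(winding_rE pil) (cop_mul x y (winding_r_bilinear pil (h := id) _)) //.
rewrite mulr_suml; apply: eq_bigr => q _; rewrite mulr_sumr.
by apply: eq_bigr => t _; rewrite rmorphM -scalerAl -scalerAr scalerA.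
Qed.

Lemma winding_l1 : l 1 = 1.
Proof.
rewrite (winding_lE pil) (cop1 (winding_l_bilinear pil (h := id) _)) //.
by rewrite rmorph1 scale1r.
Qed.

Lemma winding_r1 : r 1 = 1.
Proof.
rewrite (winding_rE pil) (cop1 (winding_r_bilinear pil (h := id) _)) //.
by rewrite rmorph1 scale1r.
Qed.

Lemma conv_exp_scalar m : scalar (conv_exp pi m).
Proof.
elim: m => [|m IH]; first exact: counit_scalar.
exact: conv_scalar pil IH.
Qed.

Lemma iter_winding_l m a : iter m l a = winding_l (conv_exp pi m) a.
Proof.
elim: m a => [|m IH] a; first by rewrite /= winding_l_counit.
by rewrite iterSr IH winding_l_comp //; apply: conv_exp_scalar.
Qed.

Lemma iter_winding_r m a : iter m r a = winding_r (conv_exp pi m) a.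
Proof.
elim: m a => [|m IH] a; first by rewrite /= winding_r_counit.
by rewrite iterS IH winding_r_comp //; apply: conv_exp_scalar.
Qed.

Let bilS : bilinear_for *:%R *:%R (fun x y : A => S y ⊗ S x).
Proof. by split=> u c x y /=; rewrite (@antipode_linear k A) !bil. Qed.

(** [S] exchanges the two legs of the coproduct, so that [l] applied to [S x] is
   [S] applied to the right winding of [x] by [pi] composed with [S], which is
   the convolution inverse of [pi]. *)
Lemma winding_l_antipode a : l (S (r a)) = S a.
Proof.
have Sl := @antipode_linear k A.
have lS x : l (S x) = \sum_(t <- cop x) pi (S t.2) *: S t.1.
  rewrite (winding_lE pil)
    (cop_ext (winding_l_bilinear pil (h := id) _) (comul_antipode x)) //.
rewrite (winding_rE pil) (linear_fun_sum Sl) (linear_fun_sum (winding_l_linear pil)).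
have T : trilinear (fun x y z : A => (pi z * pi (S y)) *: S x).
  split=> u v c x y /=; rewrite ?Sl ?pil ?Sl ?pil
    ?mulrDl ?mulrDr ?scalerDl ?scalerDr ?scalerA //;
    congr (_ *: _ + _).
  - by rewrite mulrC.
  - by rewrite mulrCA.
  - by rewrite mulrA.
transitivity (\sum_(q <- cop a) \sum_(t <- cop q.1) (pi q.2 * pi (S t.2)) *: S t.1).
  apply: eq_bigr => q _.
  rewrite (linear_funZ Sl) (linear_funZ (winding_l_linear pil)) lS scaler_sumr.
  by apply: eq_bigr => t _; rewrite scalerA.
rewrite (cop_assoc a T) -(sum_counitr a Sl); apply: eq_bigr => q _.
rewrite -scaler_suml; congr (_ *: _).
under eq_bigr do rewrite mulrC -rmorphM.
by rewrite -rmorph_sum sum_antipodel; exact: piA.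
Qed.

Lemma winding_r_antipode a : r (S (l a)) = S a.
Proof.
have Sl := @antipode_linear k A.
have rS x : r (S x) = \sum_(t <- cop x) pi (S t.1) *: S t.2.
  rewrite (winding_rE pil)
    (cop_ext (winding_r_bilinear pil (h := id) _) (comul_antipode x)) //.
rewrite (winding_lE pil) (linear_fun_sum Sl) (linear_fun_sum (winding_r_linear pil)).
have T : trilinear (fun x y z : A => (pi x * pi (S y)) *: S z).
  split=> u v c x y /=; rewrite ?Sl ?pil ?Sl ?pil
    ?mulrDl ?mulrDr ?scalerDl ?scalerDr ?scalerA //;
    congr (_ *: _ + _).
  - by rewrite mulrA.
  - by rewrite mulrCA.
  - by rewrite mulrC.
transitivity (\sum_(q <- cop a) \sum_(t <- cop q.2) (pi q.1 * pi (S t.1)) *: S t.2).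
  apply: eq_bigr => q _.
  rewrite (linear_funZ Sl) (linear_funZ (winding_r_linear pil)) rS scaler_sumr.
  by apply: eq_bigr => t _; rewrite scalerA.
rewrite -(cop_assoc a T) -(sum_counitl a Sl); apply: eq_bigr => q _.
rewrite -scaler_suml; congr (_ *: _).
under eq_bigr do rewrite -rmorphM.
by rewrite -rmorph_sum sum_antipoder; exact: piA.
Qed.

Section Order.
Variables (n : nat) (w : k).
Hypotheses (pi_order : conv_order pi n) (wP : n.-primitive_root w).

Lemma winding_l_action : cyclic_action n w l.
Proof.
split=> //.
- exact: winding_l_linear pil.
- exact: winding_lM.
- exact: winding_l1.
- by move=> a; have [_ E _] := pi_order; rewrite iter_winding_l E winding_l_counit.
Qed.

Lemma winding_r_action : cyclic_action n w r.
Proof.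
split=> //.
- exact: winding_r_linear pil.
- exact: winding_rM.
- exact: winding_r1.
- by move=> a; have [_ E _] := pi_order; rewrite iter_winding_r E winding_r_counit.
Qed.

Let al := winding_l_action.
Let ar := winding_r_action.
Let n0 : (0 < n)%N := prim_order_gt0 wP.
Let wn : w ^+ n = 1 := prim_expr_order wP.
Local Notation degl := (degree w l).
Local Notation degr := (degree w r).
Local Notation p := (component n w l).
Local Notation q := (component n w r).

Lemma winding_lr a : l (r a) = r (l a).
Proof. exact: winding_commute. Qed.

Lemma component_r_degree_l i j a : degl i a -> degl i (q j a).
Proof.
rewrite /degree /= => ha.
have H := component_commute n w j (winding_l_linear pil) (fun b => esym (winding_lr b)).
by rewrite -H ha (linear_funZ (component_linear ar j)).
Qed.

Lemma component_l_degree_r i j a : degr i a -> degr i (p j a).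
Proof.
rewrite /degree /= => ha.
have H := component_commute n w j (winding_r_linear pil) (fun b => winding_lr b).
by rewrite -H ha (linear_funZ (component_linear al j)).
Qed.

(** The eigenprojections are windings by linear combinations of the powers of
   [pi], which need not be multiplicative. *)
Definition eigenfunctional i (a : A) : k := counit (p i a).

Lemma eigenfunctional_scalar i : scalar (eigenfunctional i).
Proof.
move=> c x y; rewrite /eigenfunctional (component_linear al i).
exact: counit_scalar.
Qed.

Let chiE i a : eigenfunctional i a =
  n%:R^-1 * \sum_(m < n) w^-1 ^+ (i * m) * conv_exp pi m a.
Proof.
have el : linear (@counit k A : A -> k^o) by exact: counit_scalar.
rewrite /eigenfunctional /component (linear_funZ el) (linear_fun_sum el).
congr (_ * _); apply: eq_bigr => m _; rewrite (linear_funZ el) iter_winding_l.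
by rewrite counit_winding_l //; apply: conv_exp_scalar.
Qed.

Lemma component_l_winding i a : p i a = winding_l (eigenfunctional i) a.
Proof.
rewrite (winding_lE (eigenfunctional_scalar i)) /component.
under eq_bigr do rewrite iter_winding_l (winding_lE (conv_exp_scalar _)) scaler_sumr.
rewrite exchange_big scaler_sumr; apply: eq_bigr => t _ /=.
rewrite chiE -scalerA scaler_suml; congr (_ *: _).
by apply: eq_bigr => m _; rewrite scalerA.
Qed.

Lemma component_r_winding i a : q i a = winding_r (eigenfunctional i) a.
Proof.
rewrite (winding_rE (eigenfunctional_scalar i)) /component.
under eq_bigr do rewrite iter_winding_r (winding_rE (conv_exp_scalar _)) scaler_sumr.
rewrite exchange_big scaler_sumr; apply: eq_bigr => t _ /=.
rewrite chiE -scalerA scaler_suml; congr (_ *: _).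
by apply: eq_bigr => m _; rewrite scalerA.
Qed.

Let idl : linear (id : A -> A). Proof. by []. Qed.

Lemma comul_component_l i a : comul (p i a) = tmap (p i) id (comul a).
Proof.
have E : p i = winding_l (eigenfunctional i) by apply/funext/component_l_winding.
by rewrite E; apply: comul_winding_l; apply: eigenfunctional_scalar.
Qed.

Lemma comul_component_r i a : comul (q i a) = tmap id (q i) (comul a).
Proof.
have E : q i = winding_r (eigenfunctional i) by apply/funext/component_r_winding.
by rewrite E; apply: comul_winding_r; apply: eigenfunctional_scalar.
Qed.

Lemma tmap_component_swap i a :
  tmap (q i) id (comul a) = tmap id (p i) (comul a).
Proof.
have E1 : p i = winding_l (eigenfunctional i) by apply/funext/component_l_winding.
have E2 : q i = winding_r (eigenfunctional i) by apply/funext/component_r_winding.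
by rewrite E1 E2; apply: tmap_winding_swap; apply: eigenfunctional_scalar.
Qed.

(** The projections of [comul a] to [A_is ⊗ A_sj], for all [s] at once. *)
Lemma comul_bidegree i j a : degl i a -> degr j a ->
  comul a = \sum_(t <- cop a) p i t.1 ⊗ q j t.2.
Proof.
move=> hl hr.
rewrite -{1}(component_id ar hr) comul_component_r.
rewrite -{1}(component_id al hl) comul_component_l (copE a).
rewrite (tmap_sum (component_linear al i) idl).
by rewrite (tmap_sum idl (component_linear ar j)).
Qed.

Lemma conv_exp_eq_counit m : (forall a, conv_exp pi m a = counit a) ->
  (0 < m)%N -> (n <= m)%N.
Proof.
by move=> E m0; have [_ _ H] := pi_order; apply: H => //; apply/funext.
Qed.

(** The degrees of eigenvectors on which [counit] does not vanish form a
   submonoid; it is all of [Z/n], for otherwise some power of [pi] with an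
   exponent below [n] would agree with [counit]. *)
Lemma counit_neq0_degree i : exists a, [/\ degl i a, degr i a & counit a = 1].
Proof.
have el : linear (@counit k A : A -> k^o) by exact: counit_scalar.
pose P i := exists a, degl i a /\ counit a <> 0.
have [e [e0 en PE]] : exists e,
    [/\ (0 < e)%N, (e %| n)%N & forall i, P i <-> (e %| i)%N].
  apply: submonoid_mod => //.
  - exists 1; split; first exact: degree_one al.
    by rewrite counit1; apply/eqP; rewrite oner_neq0.
  - move=> i1 j [a [ha a0]] [b [hb b0]]; exists (a * b); split.
      exact: (degreeM al).
    by rewrite counitM => /eqP; rewrite mulf_eq0 => /orP [/eqP|/eqP].
  - move=> i1 j ij [a [ha a0]]; exists a; split=> //.
    by apply: (degree_ext _ ha); apply/eqP; rewrite (eq_prim_root_expr wP) ij.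
have emn : (e * (n %/ e))%N = n by rewrite mulnC divnK.
have e1 : e = 1%N.
  have m0 : (0 < n %/ e)%N by rewrite divn_gt0 // dvdn_leq.
  suff H : (n <= n %/ e)%N.
    apply/eqP; rewrite eqn_leq e0 andbT -(leq_pmul2r m0) emn mul1n //.
  apply: conv_exp_eq_counit => // a.
  rewrite -(counit_winding_l (conv_exp_scalar _)) -iter_winding_l.
  move: a; apply: (degree_span al).
  - by rewrite (linear_fun0 (iter_action_linear al _)).
  - move=> x y hx hy.
    by rewrite (linear_funD (iter_action_linear al _)) !(linear_funD el) hx hy.
  - move=> j a _ ha; rewrite (degree_iter al _ ha) (linear_funZ el).
    have [a0|a0] := pselect (counit a = 0); first by rewrite a0 scaler0.
    have /PE /dvdnP [u ->] : P j by exists a.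
    by rewrite -mulnA emn mulnC exprM wn expr1n scale1r.
have [a [ha a0]] : P i by apply/PE; rewrite e1 dvd1n.
have qa : counit (q i a) = counit a.
  rewrite component_r_winding counit_winding_r; last exact: eigenfunctional_scalar.
  by rewrite /eigenfunctional (component_id al ha).
exists ((counit a)^-1 *: q i a); split.
- by apply: (degreeZ al); apply: component_r_degree_l.
- by apply: (degreeZ ar); apply: (component_degree ar).
- by rewrite (linear_funZ el) qa [LHS]mulVf //; apply/eqP.
Qed.

Lemma antipode_degree_l i j a : w ^+ (i + j) = 1 -> degr i a -> degl j (S a).
Proof.
have Sl := @antipode_linear k A.
move=> ij ha; have := winding_l_antipode a.
rewrite ha (linear_funZ Sl) (linear_funZ (winding_l_linear pil)) => E.
by rewrite /degree /= -[in RHS]E scalerA -exprD addnC ij scale1r.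
Qed.

Lemma antipode_degree_r i j a : w ^+ (i + j) = 1 -> degl i a -> degr j (S a).
Proof.
have Sl := @antipode_linear k A.
move=> ij ha; have := winding_r_antipode a.
rewrite ha (linear_funZ Sl) (linear_funZ (winding_r_linear pil)) => E.
by rewrite /degree /= -[in RHS]E scalerA -exprD addnC ij scale1r.
Qed.

(** [1] is the sum of the [a_1 S(a_2)], where [a_1] has left degree [i] and
   [a_2] has right degree [i]. *)
Lemma winding_l_strong i j : w ^+ (i + j) = 1 -> exists s : seq (A * A),
    (forall t, t \in s -> degl i t.1 /\ degl j t.2) /\
    \sum_(t <- s) t.1 * t.2 = 1.
Proof.
move=> ij; have [a [hl hr a1]] := counit_neq0_degree i.
exists [seq (p i t.1, S (q i t.2)) | t <- cop a]; split.
  move=> _ /mapP [t _ ->]; split; first exact: (component_degree al).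
  by apply: (antipode_degree_l ij); apply: (component_degree ar).
rewrite big_map; have := sum_antipoder a; rewrite a1 scale1r => <-.
rewrite (cop_ext (f := fun x y => x * S y) _ (comul_bidegree hl hr)) //.
by split=> u c x y /=; rewrite ?antipode_linear ?(mulrDl, mulrDr) -?scalerAl -?scalerAr.
Qed.

Lemma winding_r_strong i j : w ^+ (i + j) = 1 -> exists s : seq (A * A),
    (forall t, t \in s -> degr i t.1 /\ degr j t.2) /\
    \sum_(t <- s) t.1 * t.2 = 1.
Proof.
move=> ij; have [a [hl hr a1]] := counit_neq0_degree j.
exists [seq (S (p j t.1), q j t.2) | t <- cop a]; split.
  move=> _ /mapP [t _ ->]; split; last exact: (component_degree ar).
  by apply: (@antipode_degree_r j i); [rewrite addnC|apply: (component_degree al)].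
rewrite big_map; have := sum_antipodel a; rewrite a1 scale1r => <-.
rewrite (cop_ext (f := fun x y => S x * y) _ (comul_bidegree hl hr)) //.
by split=> u c x y /=; rewrite ?antipode_linear ?(mulrDl, mulrDr) -?scalerAl -?scalerAr.
Qed.

End Order.
End Characters.

(** * The bigrading by both winding automorphisms *)

Lemma closed_field_primitive_root (k : closedFieldType) n :
  (0 < n)%N -> n%:R != 0 :> k -> exists w : k, n.-primitive_root w.
Proof.
move=> n0 nk; have [rs rsE] := closed_field_poly_normal ('X^n - 1 : {poly k}).
have mon : 'X^n - 1 \is @monic k by rewrite monicXnsubC.
move: rsE; rewrite (monicP mon) scale1r => rsE.
have szrs : size rs = n.
  by apply: succn_inj; rewrite -(size_prod_XsubC rs id) -rsE size_XnsubC.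
have /hasP [z _ zP] : has n.-primitive_root rs.
  apply: has_prim_root => //; last by rewrite szrs.
    apply/allP => z zr; apply/unity_rootP; apply/eqP.
    have : root ('X^n - 1) z by rewrite rsE root_prod_XsubC.
    by rewrite rootE !hornerE subr_eq0.
  by rewrite -separable_prod_XsubC -rsE separable_Xn_sub_1.
by exists z.
Qed.

Lemma natr_neq0_of_coprime (k : fieldType) p n : has_characteristic k p ->
  ((0 < p)%N -> coprime n p) -> (0 < n)%N -> n%:R != 0 :> k.
Proof.
move=> [[-> k0] _ n0|pk cop n0].
  by rewrite ((pcharf0P k).1 k0) -lt0n.
have pp := pcharf_prime pk; rewrite -(dvdn_pcharf pk).
by rewrite -prime_coprime // coprime_sym; apply/cop/prime_gt0.
Qed.

Lemma fixed_by_cyclic_group (k : fieldType) (A : hopfAlgType k) (s : A -> A) a :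
  fixed_by (cyclic_group s) a <-> s a = a.
Proof.
split=> [H|sa t [m]]; first by apply: H; exists 1%N; left.
have sma : iter m s a = a by elim: m => //= m ->.
by move=> [->|[_ tK]] //; rewrite -[in LHS]sma tK.
Qed.

Lemma sum_tens_sub (k : fieldType) (V W : lmodType k) (B : set V) (C : set W)
    (I : eqType) (s : seq I) (u : I -> V) (v : I -> W) :
  (forall i, i \in s -> B (u i) /\ C (v i)) ->
  tens_sub B C (\sum_(i <- s) u i ⊗ v i).
Proof.
move=> H; exists [seq (u i, v i) | i <- s]; last by rewrite big_map.
by move=> _ /mapP [i si ->]; apply: H.
Qed.

Section Bigrading.
Variables (k : fieldType) (A : hopfAlgType k) (pi : {lrmorphism A -> k | *%R}).
Variables (n : nat) (w : k).
Hypotheses (pi_order : conv_order pi n) (wP : n.-primitive_root w)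
  (A_PIdeg : PI_degree A n)
  (A0l_comm : forall x y, A0l pi x -> A0l pi y -> x * y = y * x)
  (A0l_domain : forall x y, A0l pi x -> A0l pi y -> x * y = 0 -> x = 0 \/ y = 0)
  (Gl_Gr : Gl pi `&` Gr pi = [set id]).

Notation l := (winding_l pi).
Notation r := (winding_r pi).
Notation S := (@antipode k A).
Local Notation degl := (degree w l).
Local Notation degr := (degree w r).
Local Notation p := (component n w l).
Local Notation q := (component n w r).

Let n0 : (0 < n)%N := prim_order_gt0 wP.
Let wn : w ^+ n = 1 := prim_expr_order wP.
Let al : cyclic_action n w l := winding_l_action pi_order wP.
Let ar : cyclic_action n w r := winding_r_action pi_order wP.
Let inv i := (i * n.-1)%N.

Let inv_r i : w ^+ (i + inv i) = 1.
Proof. by rewrite /inv -mulnS prednK // mulnC exprM wn expr1n. Qed.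

Let S_inj : injective S := antipode_injective A_PIdeg.1.

Lemma degl0E a : degl 0 a <-> A0l pi a.
Proof. by rewrite /degree /= expr0 scale1r /A0l /Gl fixed_by_cyclic_group. Qed.

Lemma degr0E a : degr 0 a <-> A0r pi a.
Proof. by rewrite /degree /= expr0 scale1r /A0r /Gr fixed_by_cyclic_group. Qed.

Lemma A0E a : A0 pi a <-> degl 0 a /\ degr 0 a.
Proof. by rewrite degl0E degr0E. Qed.

Lemma winding_l_grading : strong_grading n w l.
Proof.
split; first exact: al.
- exact: (winding_l_strong pi_order wP).
- by move=> x y /degl0E hx /degl0E hy; apply: A0l_comm.
- by move=> x y /degl0E hx /degl0E hy; apply: A0l_domain.
Qed.

(** The antipode is injective and reverses products, and it maps the degree
   zero part of the right grading to that of the left one. *)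
Lemma winding_r_grading : strong_grading n w r.
Proof.
have SD a : degr 0 a -> A0l pi (S a).
  by move=> ha; apply/degl0E; apply: (antipode_degree_l (i := 0) _ ha); rewrite expr0.
split; first exact: ar.
- exact: (winding_r_strong pi_order wP).
- move=> x y /SD hx /SD hy; apply: S_inj.
  by rewrite !antipodeM; apply: A0l_comm.
- move=> x y /SD hx /SD hy /(congr1 S).
  have S0 : S 0 = 0 by exact: linear_fun0 (@antipode_linear k A).
  rewrite antipodeM S0 => /(A0l_domain hy hx) [E|E]; [right|left];
  by apply: S_inj; rewrite S0.
Qed.

Let gl := winding_l_grading.
Let gr := winding_r_grading.

Lemma component_r_neq0 a : a <> 0 -> exists j, q j a <> 0.
Proof.
move=> a0; apply: contrapT => H; apply: a0; rewrite -(component_sum ar a).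
rewrite big1 // => j _; apply: contrapT => qj; apply: H; by exists (val j).
Qed.

(** If the degrees [j] below were the multiples of some [e > 1], the [n %/ e]-th power
   of the right winding would fix the degree-zero component, and so act on
   each component by a scalar; it would be a power of the left winding. *)
Lemma degl0_degr_nonzero j : exists x, [/\ degl 0 x, degr j x & x <> 0].
Proof.
pose P j := exists x, [/\ degl 0 x, degr j x & x <> 0].
have [e [e0 en PE]] : exists e,
    [/\ (0 < e)%N, (e %| n)%N & forall i, P i <-> (e %| i)%N].
  apply: submonoid_mod => //.
  - exists 1; split; [exact: degree_one al|exact: degree_one ar|].
    by apply/eqP; rewrite oner_neq0.
  - move=> i j' [x [xl xr x0]] [y [yl yr y0]]; exists (x * y); split.
    + exact: (degreeM al xl yl).
    + exact: (degreeM ar xr yr).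
    + by move=> /(homogeneous_mul_eq0 gl xl yl) [].
  - move=> i j' ij [x [xl xr x0]]; exists x; split=> //.
    by apply: (degree_ext _ xr); apply/eqP; rewrite (eq_prim_root_expr wP) ij.
pose m := (n %/ e)%N; have emn : (e * m)%N = n by rewrite mulnC divnK.
have m0 : (0 < m)%N by rewrite divn_gt0 // dvdn_leq.
have wm i : P i -> w ^+ (m * i) = 1.
  by move=> /PE /dvdnP [u ->]; rewrite mulnCA [(m * e)%N]mulnC emn mulnC exprM wn expr1n.
suff H : (n <= m)%N.
  apply/PE; suff -> : e = 1%N by rewrite dvd1n.
  by apply/eqP; rewrite eqn_leq e0 andbT -(leq_pmul2r m0) emn mul1n.
have [y [yl y0]] := homogeneous_nonzero gl 1.
have [t0 qy0] := component_r_neq0 y0.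
pose x := q t0 y.
have xl : degl 1 x by apply: component_r_degree_l.
have xr : degr t0 x by exact: component_degree ar t0 y.
have rl a : iter m r a = iter (t0 * m) l a.
  move: a; apply: (degree_span al).
  - by rewrite (linear_fun0 (iter_action_linear ar _))
      (linear_fun0 (iter_action_linear al _)).
  - move=> u v hu hv; rewrite (linear_funD (iter_action_linear ar _)).
    by rewrite (linear_funD (iter_action_linear al _)) hu hv.
  move=> i a _ ha; rewrite (degree_iter al _ ha).
  rewrite -{1}(component_sum ar a) (linear_fun_sum (iter_action_linear ar _)).
  rewrite -{2}(component_sum ar a) scaler_sumr; apply: eq_bigr => u _.
  have bl : degl i (q u a) by exact: component_r_degree_l.
  have br : degr u (q u a) by exact: component_degree ar u a.
  rewrite (degree_iter ar _ br).
  have [->|b0] := pselect (q u a = 0); first by rewrite !scaler0.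
  congr (_ *: _).
  have [v' [vl' v0']] := homogeneous_nonzero gl (inv i).
  have [z qv0] := component_r_neq0 v0'.
  have vl : degl (inv i) (q z v') by exact: component_r_degree_l.
  have vr : degr z (q z v') by exact: component_degree ar z v'.
  have Pz c s : degl i c -> degr s c -> c <> 0 -> P (z + s)%N.
    move=> cl cr c0; exists (q z v' * c); split.
    + by apply: (degree_ext _ (degreeM al vl cl)); rewrite addnC inv_r.
    + exact: (degreeM ar vr cr).
    + by move=> /(homogeneous_mul_eq0 gl vl cl) [].
  have xil : degl i (x ^+ i) by apply: (degree_ext _ (degreeX al i xl)); rewrite mul1n.
  have xi0 := homogeneous_expr_neq0 (m := i) gl xl qy0.
  have := wm _ (Pz _ _ bl br b0); have := wm _ (Pz _ _ xil (degreeX ar i xr) xi0).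
  rewrite !mulnDr !exprD => <- /eqP.
  rewrite -subr_eq0 -mulrBr mulf_eq0 expf_eq0 (prim_root_eq0 wP) (gtn_eqF n0) andbF /=.
  rewrite subr_eq0 => /eqP E; rewrite mulnC E.
  by rewrite mulnCA [in RHS]mulnCA (mulnC m).
have : (Gl pi `&` Gr pi) (iter m r).
  split; last by exists m; left.
  by exists (t0 * m)%N; left; apply/funext.
rewrite Gl_Gr /= => rid.
apply: (conv_exp_eq_counit pi_order) => // a.
rewrite -(counit_winding_r (conv_exp_scalar pi m)) -iter_winding_r.
by rewrite rid.
Qed.

(** An element of [A_00] commutes with some nonzero element of each right
   degree, taken in the commutative ring [A0l pi]. *)
Lemma A0_central : A0 pi `<=` center A.
Proof.
move=> c /A0E [cl cr]; apply: (degree_span ar).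
- by rewrite mul0r mulr0.
- by move=> x y hx hy; rewrite mulrDl mulrDr hx hy.
- move=> j a _ ha; have [x [xl xr x0]] := degl0_degr_nonzero j.
  symmetry; apply: (commute_degree gr cr xr x0 _ ha).
  exact: (grading_comm gl).
Qed.

Lemma center_A0 : center A `<=` A0 pi.
Proof.
by move=> z zC; apply/A0E; split;
  [apply: (center_degree0 gl)|apply: (center_degree0 gr)] => //; exact: A_PIdeg.2.
Qed.

(** For [d] of bidegree [(0, s)] the power [d ^+ n] is central, so that the twist
   [d'] of [d] satisfies [d' ^+ n = d ^+ n], and [d'] is a multiple of [d] by a
   root of unity. It is the same for all [d], because the product of [d] with
   an element of bidegree [(0, - s)] is central. If it is [1], [d] commutes
   with degree one, hence with all powers of a nonzero element of degree one,
   and is central, so that its right degree is zero. *)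
Lemma bidegree_commutation s : exists z : k,
  (forall d a, degl 0 d -> degr s d -> degl 1 a -> a * d = z *: (d * a)) /\
  (z = 1 -> w ^+ s = 1).
Proof.
have [d0 [dl dr dN0]] := degl0_degr_nonzero s.
have [d' [dl' dE]] := degree_twist gl 1 dl.
have [h [hh h0]] := homogeneous_nonzero gl 1.
have hpow m : h * d0 ^+ m = d' ^+ m * h.
  elim: m => [|m IH]; first by rewrite !expr0 mulr1 mul1r.
  by rewrite exprS mulrA dE // -mulrA IH mulrA -exprS.
have dnA0 : A0 pi (d0 ^+ n).
  apply/A0E; split; first by apply: (degree_ext _ (degreeX al n dl)); rewrite mul0n.
  by apply: (degree_ext _ (degreeX ar n dr)); rewrite mulnC exprM wn expr1n.
have dn : d' ^+ n = d0 ^+ n.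
  have X0 x : degl 0 x -> degl 0 (x ^+ n).
    by move=> hx; apply: (degree_ext _ (degreeX al n hx)); rewrite mul0n.
  have E : (d' ^+ n - d0 ^+ n) * h = 0.
    by rewrite mulrBl -hpow -(A0_central dnA0 h) subrr.
  have [/eqP|//] := homogeneous_mul_eq0 gl (degreeB al (X0 _ dl') (X0 _ dl)) hh E.
  by rewrite subr_eq0 => /eqP.
have [i dwi] : exists i : nat, d' = w ^+ i *: d0.
  apply: contrapT => H.
  have ZX x (c : k) m : (c *: x : A) ^+ m = c ^+ m *: x ^+ m by rewrite exprZn.
  (* each factor [d' - w ^+ i *: d0] of [d' ^+ n - d0 ^+ n] being nonzero, its
     cofactor vanishes; the sum of the cofactors is [n%:R *: d' ^+ n.-1] *)
  have E (i : 'I_n) : \sum_(j < n) d' ^+ (n.-1 - j) * (w ^+ i *: d0) ^+ j = 0.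
    have wd : degl 0 (w ^+ i *: d0) by exact: (degreeZ al).
    have cm : GRing.comm d' (w ^+ i *: d0) by exact: (grading_comm gl).
    have := subrXX_comm n cm; rewrite ZX -exprM mulnC exprM wn expr1n scale1r dn subrr.
    move=> /esym F; have sd : degl 0
      (\sum_(j < n) d' ^+ (n.-1 - j) * (w ^+ i *: d0) ^+ j).
      apply: (degree_sum al) => j _.
      by apply: (degree_ext _ (degreeM al (degreeX al _ dl') (degreeX al _ wd)));
      rewrite !mul0n.
    have [/eqP|//] := homogeneous_mul_eq0 gl (degreeB al dl' wd) sd F.
    by rewrite subr_eq0 => /eqP E; case: H; exists i.
  have : \sum_(i < n) \sum_(j < n) d' ^+ (n.-1 - j) * (w ^+ i *: d0) ^+ j = 0.
    by rewrite big1.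
  rewrite exchange_big /= (bigD1 (Ordinal n0)) //= [X in _ + X]big1 ?addr0.
    under eq_bigr do rewrite expr0 mulr1 subn0.
    rewrite sumr_const card_ord -scaler_nat => /eqP.
    rewrite scaler_eq0 (negPf (prim_root_natf_neq0 wP)) /= => /eqP.
    case: (n) (n0) dn => // m _ /= E' F.
    have d1 : d0 ^+ m.+1 = 0 by rewrite -E' exprS F mulr0.
    by apply: (homogeneous_expr_neq0 (m := m.+1) gl dl dN0).
  move=> j j0; under eq_bigr do rewrite ZX -scalerAr -exprM mulnC exprM.
  rewrite -scaler_suml geometric_root ?scale0r //.
    by rewrite -exprM mulnC exprM wn expr1n.
  by rewrite -(prim_order_dvd wP) gtnNdvd // lt0n.
exists (w ^+ i); split.
- move=> d a hl hr ha.
  have [e [el er e0]] := degl0_degr_nonzero (inv s).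
  have [e' [el' eE]] := degree_twist gl 1 el.
  have ed x : degl 0 x -> degr s x -> center A (e * x).
    move=> xl xr; apply: A0_central; apply/A0E; split.
      exact: (degreeM al el xl).
    by apply: (degree_ext _ (degreeM ar er xr)); rewrite addnC inv_r.
  have e'E : e = w ^+ i *: e'.
    have F : (e - w ^+ i *: e') * d0 = 0.
      have F : (e - w ^+ i *: e') * d0 * h = 0.
        rewrite mulrBl mulrBl (ed d0 dl dr h) mulrA eE // -!mulrA dE // dwi.
        by rewrite -!scalerAl -!scalerAr subrr.
      have hd : degl 0 ((e - w ^+ i *: e') * d0).
        by apply: (degreeM al (i := 0) (j := 0)) dl;
        apply: (degreeB al el); apply: (degreeZ al).
      by have [|] := homogeneous_mul_eq0 gl hd hh F.
    have hd : degl 0 (e - w ^+ i *: e') by apply: (degreeB al el); apply: (degreeZ al).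
    have [/eqP|//] := homogeneous_mul_eq0 gl hd dl F.
    by rewrite subr_eq0 => /eqP.
  have F : e' * (a * d - w ^+ i *: (d * a)) = 0.
    rewrite mulrBr mulrA -eE // -mulrA -(ed d hl hr a) {1}e'E.
    by rewrite -!scalerAl -scalerAr -mulrA subrr.
  have hd : degl 1 (a * d - w ^+ i *: (d * a)).
    apply: (degreeB al); first exact: (degreeM al ha hl).
    by apply: (degreeZ al); apply: (degreeM al hl ha).
  have [e'0|/eqP] := homogeneous_mul_eq0 gl el' hd F.
    by case: e0; rewrite e'E e'0 scaler0.
  by rewrite subr_eq0 => /eqP.
- move=> w1; have hd : h * d0 = d0 * h by rewrite dE // dwi w1 scale1r.
  have dC : center A d0.
    apply: (degree_span al); first by rewrite mul0r mulr0.
      by move=> x y hx hy; rewrite mulrDl mulrDr hx hy.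
    move=> j a _ ha; symmetry.
    have hj : degl j (h ^+ j) by apply: (degree_ext _ (degreeX al j hh)); rewrite mul1n.
    apply: (commute_degree gl dl hj (homogeneous_expr_neq0 (m := j) gl hh h0) _ ha).
    by apply: esym; apply: commrX; apply: esym.
  have /A0E [_ dr0] := center_A0 dC.
  have : (w ^+ s - 1) *: d0 = 0.
    by rewrite scalerBl -dr; move: dr0; rewrite /degree /= expr0 => ->; rewrite subrr.
  by move=> /eqP; rewrite scaler_eq0 => /orP [|/eqP //]; rewrite subr_eq0 => /eqP.
Qed.

Let idl : linear (id : A -> A). Proof. by []. Qed.

(** Conjugation by [comul x], with [x] of bidegree [(1, 0)], fixes [comul z] and
   multiplies the component of [comul z] in [A_0s ⊗ A_s0] by the scalar of
   [bidegree_commutation], which is not [1] unless [s] is zero. *)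
Lemma comul_A0 z : A0 pi z -> tens_sub (A0 pi) (A0 pi) (comul z).
Proof.
move=> zA0; have zC := A0_central zA0.
have /A0E [zl zr] := zA0.
have [x [xl xr x0]] : exists x, [/\ degl 1 x, degr 0 x & x <> 0].
  have [y [yl y0]] := homogeneous_nonzero gl 1.
  have [j qy0] := component_r_neq0 y0.
  have ql : degl 1 (q j y) by exact: component_r_degree_l.
  have qr : degr j (q j y) by exact: component_degree ar j y.
  have [u [ul ur u0]] := degl0_degr_nonzero (inv j).
  exists (q j y * u); split.
  - exact: (degreeM al ql ul).
  - by apply: (degree_ext _ (degreeM ar qr ur)); rewrite inv_r.
  - by move=> /(homogeneous_mul_eq0 gl ql ul) [].
have [zeta zetaP] := choice bidegree_commutation.
have ql s : linear (q s) := component_linear ar s.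
have tl s : linear (tmap (q s) (id : A -> A)) := tmap_linear (ql s) idl.
pose T s := tmap (q s) (id : A -> A) (comul z).
pose u s (c : A * A) := q s (p 0 c.1).
pose v (c : A * A) := q 0 c.2.
have TE s : T s = \sum_(c <- cop z) u s c ⊗ v c.
  by rewrite /T (comul_bidegree pi_order wP zl zr) (tmap_sum (ql s) idl).
have ul s c : degl 0 (u s c).
  by apply: component_r_degree_l => //; apply: (component_degree al).
have ur s c : degr s (u s c) by exact: (component_degree ar).
have vr c : degr 0 (v c) by exact: (component_degree ar).
have xT s : comul x * T s = zeta s *: (T s * comul x).
  rewrite (comul_bidegree pi_order wP xl xr) TE !mulr_suml scaler_sumr.
  under eq_bigr do rewrite mulr_sumr.
  rewrite exchange_big; apply: eq_bigr => c _ /=.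
  rewrite mulr_sumr scaler_sumr; apply: eq_bigr => d _.
  transitivity ((p 1 d.1 * u s c) ⊗ (q 0 d.2 * v c)); first exact: tens_mulE.
  have -> : (u s c ⊗ v c) * (p 1 d.1 ⊗ q 0 d.2) = (u s c * p 1 d.1) ⊗ (v c * q 0 d.2).
    exact: tens_mulE.
  have [zs _] := zetaP s.
  rewrite (zs _ _ (ul s c) (ur s c) (component_degree al 1 d.1)) tensZl.
  by rewrite (grading_comm gr (component_degree ar 0 d.2) (vr c)).
have Tsum : \sum_(s < n) T s = comul z.
  rewrite /T (copE z).
  under eq_bigr do rewrite (tmap_sum (ql _) idl).
  rewrite exchange_big; apply: eq_bigr => c _ /=.
  by rewrite -(linear_fun_sum ((tensor_bilinear A A).1 c.2)) (component_sum ar).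
have Tq s t : w ^+ s != w ^+ t -> tmap (q s) (id : A -> A) (T t) = 0.
  move=> st; rewrite TE (tmap_sum (ql s) idl) big1 // => c _.
  rewrite (component_neq ar (ur t c) st).
  exact: linear_fun0 ((tensor_bilinear A A).1 _).
have Tqq s : tmap (q s) (id : A -> A) (T s) = T s.
  rewrite TE (tmap_sum (ql s) idl); apply: eq_bigr => c _.
  by rewrite (component_id ar (ur s c)).
have Z0 : \sum_(s < n) (zeta s - 1) *: T s = 0.
  apply: (@comul_regular _ _ x).
    by move=> a; apply: (homogeneous_regular gl xl).
  have DM := (@comul_monoid_morphism k A : monoid_morphism _).2.
  have : comul x * comul z = comul z * comul x by rewrite -!DM zC.
  rewrite -Tsum mulr_sumr !mulr_suml => E.
  rewrite (eq_bigr (fun s : 'I_n => comul x * T s - T s * comul x)).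
    by rewrite sumrB E subrr.
  move=> s _; rewrite xT scalerBl scale1r mulrBl; congr (_ - _).
  exact: (linear_funZ (tens_mul_linearl (comul x))).
have T0 s : (0 < s < n)%N -> T s = 0.
  move=> /andP [s0 sn]; have := congr1 (tmap (q s) (id : A -> A)) Z0.
  rewrite (linear_fun_sum (tl s)) (linear_fun0 (tl s)).
  rewrite (bigD1 (Ordinal sn)) //= (linear_funZ (tl s)) Tqq big1 ?addr0.
    move=> /eqP; rewrite scaler_eq0 subr_eq0 => /orP [/eqP zs|/eqP //].
    have [_ /(_ zs) /eqP] := zetaP s.
    by rewrite -(prim_order_dvd wP) gtnNdvd.
  move=> i ins; rewrite (linear_funZ (tl s)) Tq ?scaler0 //.
  rewrite (eq_prim_root_expr wP) !modn_small //.
  by apply: contra ins => /eqP E; apply/eqP/val_inj.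
have zT : comul z = T 0%N.
  rewrite -{1}Tsum (bigD1 (Ordinal n0)) //= big1 ?addr0 // => i i0.
  by apply: T0; rewrite ltn_ord lt0n andbT.
have zE : comul z = \sum_(c <- cop z) u 0%N c ⊗ p 0 (v c).
  rewrite {1}zT /T (tmap_component_swap pi_order wP) {1}zT TE.
  by rewrite (tmap_sum idl (component_linear al 0)).
rewrite zE; apply: sum_tens_sub => c _; split; apply/A0E; split.
- exact: ul.
- exact: ur.
- exact: (component_degree al).
- by apply: component_l_degree_r.
Qed.

End Bigrading.

Theorem theorem5p2 (k : closedFieldType) (p : nat)
    (char_k : has_characteristic k p)
    (A : hopfAlgType k)
    (A_affine : affine A) (A_noeth : noetherian A)
    (A_prime : prime_ring A) (A_PI : PI_algebra A)
    (pi : {lrmorphism A -> k | *%R}) (n : nat)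
    (pi_order : conv_order pi n) (A_PIdeg : PI_degree A n)
    (A0l_Dedekind : Dedekind_subring (A0l pi))
    (n_coprime_p : (0 < p)%N -> coprime n p)
    (Gl_Gr : Gl pi `&` Gr pi = [set id]) :
  [/\ A0 pi = A0tilde pi, A0 pi = center A & Hopf_subalgebra (A0 pi)].
Proof.
have n0 : (0 < n)%N by have [] := pi_order.
have nk := natr_neq0_of_coprime char_k n_coprime_p n0.
have [w wP] := closed_field_primitive_root n0 nk.
have [D [f [_ finj fD]]] := A0l_Dedekind.
have A0l_comm x y : A0l pi x -> A0l pi y -> x * y = y * x.
  by rewrite -fD => -[a _ <-] [b _ <-]; rewrite -!rmorphM mulrC.
have A0l_domain x y : A0l pi x -> A0l pi y -> x * y = 0 -> x = 0 \/ y = 0.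
  rewrite -fD => -[a _ <-] [b _ <-]; rewrite -rmorphM -(rmorph0 f) => /finj /eqP.
  by rewrite mulf_eq0 => /orP [] /eqP ->; [left|right]; rewrite rmorph0.
have al := winding_l_action pi_order wP.
have ar := winding_r_action pi_order wP.
have A0L := A0E pi w.
have comulA0 := comul_A0 pi_order wP A_PIdeg A0l_comm A0l_domain Gl_Gr.
have sub : subalgebra (A0 pi).
  split.
  - by apply/A0L; split; [exact: degree_one al|exact: degree_one ar].
  - move=> c x y /A0L [xl xr] /A0L [yl yr]; apply/A0L.
    by split; [exact: (degreeL al _ xl yl)|exact: (degreeL ar _ xr yr)].
  - move=> x y /A0L [xl xr] /A0L [yl yr]; apply/A0L; split.
      exact: (degreeM al xl yl).
    exact: (degreeM ar xr yr).
split; last split=> //.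
- apply/seteqP; split=> a; first exact: comulA0.
  move=> [s sA0 aE].
  rewrite -[a](sum_counitl a (f := id)) //.
  have [A1 AL AM] := sub.
  have A00 : A0 pi 0 by rewrite -[0](addNr 1) -scaleN1r; apply: AL.
  have el := @counit_scalar k A.
  rewrite (cop_ext (winding_l_bilinear el (h := id) _) aE) // big_seq.
  elim/big_ind: _ => //.
    by move=> x y hx hy; rewrite -[x]scale1r; apply: AL.
  move=> t /sA0 [_ ht]; rewrite -[_ *: _]addr0; exact: AL.
- apply/seteqP; split=> a.
    exact: (A0_central pi_order wP A_PIdeg A0l_comm A0l_domain Gl_Gr).
  exact: (center_A0 pi_order wP A_PIdeg A0l_comm A0l_domain).
- move=> b /A0L [bl br]; apply/A0L; split.
    by apply: (antipode_degree_l (i := 0) _ br); rewrite expr0.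
  by apply: (antipode_degree_r (i := 0) _ bl); rewrite expr0.
Qed.
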